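(* Let $n\ge1$, $\bm{N}=(N_0,\ldots,N_{n-1},-\sum_{i<n}N_i)\in\mathbb{Z}^{n+1}$, let $\bm{f}$ be any (not necessarily integer) point of $\mathcal{F}_n(\bm{N})$, let $s_k=\sum_{j=0}^kN_j$, and let $A=(a_{ij})=A(\bm{f})$. Then \[ K_n(\bm{N})\;\geq\;\max_{0\le i\le n-1}\Big\{\frac{(s_i+1)^{s_i+1}}{s_i^{s_i}}\Big\}\Big[\prod_{i=0}^{n-1}\frac{s_i^{s_i}}{(s_i+1)^{s_i+1}}\Big]^2\prod_{\substack{0\le i,j\le n-1\\ i+j\le n}}\frac{(a_{ij}+1)^{a_{ij}+1}}{a_{ij}^{a_{ij}}}. \]
   Context: $\mathcal{F}_n(\bm{N})$ is the set of $\bm{f}=(f_{ij})_{0\le i<j\le n}\in\mathbb{R}_{\ge0}^{\binom{n+1}{2}}$ with $\sum_{j>i} f_{ij}-\sum_{k<i} f_{ki}=N_i$ for every $i$, and $K_n(\bm{N})$ is its number of integer points. For $\bm{f}\in\mathcal{F}_n(\bm{N})$, $A(\bm{f})=(a_{ij})_{0\le i,j\le n-1}$ is defined by $a_{ij}=f_{i,n-j}$ if $i+j\le n-1$, $a_{i,n-i}=\sum_{0\le k<i}(N_k-f_{k,i})$ for $1\le i\le n-1$, and $a_{ij}=0$ if $i+j>n$. Convention $0^0=1$. *)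

(* Defs.v *)
From HB Require Import structures.
From mathcomp Require Import all_boot all_order all_algebra.
From mathcomp Require Import all_classical all_reals all_analysis.
Set Implicit Arguments. Unset Strict Implicit. Unset Printing Implicit Defensive.
Import Order.TTheory GRing.Theory Num.Theory.
Local Open Scope ring_scope.

Definition Nfull (n : nat) (N : nat -> int) (i : nat) : int :=
  if (i < n)%N then N i else - \sum_(k < n) N k.

(* f : nat -> nat -> R, only f i j with 0 <= i < j <= n are relevant. *)
Definition inFlowPolytope (R : realType) (n : nat) (N : nat -> int)
    (f : nat -> nat -> R) : Prop :=
  (forall i j : nat, (i < j)%N -> (j <= n)%N -> 0 <= f i j) /\
  (forall i : nat, (i <= n)%N ->
     \sum_(i.+1 <= j < n.+1) f i j - \sum_(0 <= k < i) f k i = (Nfull n N i)%:~R).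

(* A bound on every coordinate of an integer point of F_n(N):
   f_ij <= s_i <= sum_{k<n} |N_k|. *)
Definition flowBound (n : nat) (N : nat -> int) : nat := (\sum_(k < n) `|N k|)%N.

(* Integer points of F_n(N): nonnegative integer functions on pairs (i,j),
   vanishing unless i < j, satisfying the netflow equations.  The bounded
   codomain 'I_(flowBound n N).+1 loses no integer point. *)
Definition intFlows (n : nat) (N : nat -> int) :=
  [set g : {ffun 'I_n.+1 -> {ffun 'I_n.+1 -> 'I_(flowBound n N).+1}} |
     [forall i : 'I_n.+1, forall j : 'I_n.+1,
        ((j <= i)%N ==> (nat_of_ord (g i j) == 0%N))] &&
     [forall i : 'I_n.+1,
        (\sum_(j < n.+1 | (i < j)%N) ((g i j : nat)%:Z)
         - \sum_(k < n.+1 | (k < i)%N) ((g k i : nat)%:Z)) == Nfull n N i]].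

Definition K (n : nat) (N : nat -> int) : nat := #|intFlows n N|.

Definition spart (n : nat) (N : nat -> int) (k : nat) : int :=
  \sum_(0 <= j < k.+1) Nfull n N j.

Definition Amat (R : realType) (n : nat) (N : nat -> int) (f : nat -> nat -> R)
    (i j : nat) : R :=
  if (i + j <= n.-1)%N then f i (n - j)%N
  else if ((1 <= i)%N && (i <= n.-1)%N && (j == n - i)%N) then
    \sum_(0 <= k < i) ((N k)%:~R - f k i)
  else 0.

(* x |-> (x+1)^(x+1) / x^x, with the convention 0^0 = 1 (powR 0 0 = 1). *)
Definition Tfun (R : realType) (x : R) : R :=
  powR (x + 1) (x + 1) / powR x x.

(* Main.v *)
Require Import Defs.
From HB Require Import structures.
From mathcomp Require Import all_boot all_order all_algebra.
From mathcomp Require Import all_classical all_reals all_analysis.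
From mathcomp Require Import ring lra zify.
Import Order.TTheory GRing.Theory Num.Theory.
Local Open Scope ring_scope.
Set Implicit Arguments. Unset Strict Implicit. Unset Printing Implicit Defensive.

(* The matrix [A(f)] lies in the transportation polytope with row sums [s_i],
   column sums [s_(n-1-j)] and support [i + j <= n], and the integer points of
   that polytope inject into the integer flows.  It remains to count tables.

   The number of tables is a coefficient of [prod 1 / (1 - x_i y_j)].  For a
   log-concave sequence [a], if [L t^k <= sum_l a_l t^l] for all [t > 0], then
   [L <= a_k (k+1)^(k+1) / k^k].  Extracting the coefficients of the row and
   column variables one at a time costs one such factor per variable; the last
   variable is free by homogeneity, so its column can be chosen to carry the
   maximal factor.  The starting bound is [(1 - z) z^a <= a^a / (a+1)^(a+1)],
   multiplied over the entries of [A(f)].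

   The log-concavity needed here is that of weighted flow counts [c] of a network
   along the directions [e_p - e_q].  It follows from the stronger property that
   every matrix [(c (g + e_p + e_q))_(p,q)] has at most one positive eigenvalue,
   which is shown to be preserved when one edge is added to the network; strict
   positivity is ensured by starting from a discrete Gaussian. *)

(** * Lorentzian quadratic forms *)

Section QuadraticForms.
Variables (R : realFieldType) (V : finType).
Implicit Types (M : V -> V -> R) (u v w : V -> R).

Definition bil M u v : R := \sum_p \sum_q u p * M p q * v q.

Definition unitv (p q : V) : R := (q == p)%:R.

(* For nonnegative symmetric [M]: at most one positive eigenvalue. *)
Definition lorentzian M :=
  forall u v, 0 < bil M u u -> bil M u u * bil M v v <= bil M u v ^+ 2.

Lemma eq_bil M M' u v : (forall p q, M p q = M' p q) -> bil M u v = bil M' u v.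
Proof. by move=> e; apply: eq_bigr => p _; apply: eq_bigr => q _; rewrite e. Qed.

Lemma eq_lorentzian M M' : (forall p q, M p q = M' p q) ->
  lorentzian M -> lorentzian M'.
Proof. by move=> e h u v; rewrite -!(eq_bil _ _ e); apply: h. Qed.

Lemma bil_sym M u v : (forall p q, M p q = M q p) -> bil M u v = bil M v u.
Proof.
move=> sM; rewrite /bil exchange_big /=.
by apply: eq_bigr => p _; apply: eq_bigr => q _; rewrite sM; ring.
Qed.

Lemma bilDr M w a b u v :
  bil M w (fun p => a * u p + b * v p) = a * bil M w u + b * bil M w v.
Proof.
rewrite /bil !mulr_sumr -big_split; apply: eq_bigr => p _ /=.
by rewrite !mulr_sumr -big_split; apply: eq_bigr => q _ /=; ring.
Qed.

Lemma bilDl M w a b u v :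
  bil M (fun p => a * u p + b * v p) w = a * bil M u w + b * bil M v w.
Proof.
rewrite /bil !mulr_sumr -big_split; apply: eq_bigr => p _ /=.
by rewrite !mulr_sumr -big_split; apply: eq_bigr => q _ /=; ring.
Qed.

Lemma bil_quadD M a b u v : (forall p q, M p q = M q p) ->
  bil M (fun p => a * u p + b * v p) (fun p => a * u p + b * v p) =
  a ^+ 2 * bil M u u + 2 * a * b * bil M u v + b ^+ 2 * bil M v v.
Proof. by move=> sM; rewrite bilDl !bilDr (bil_sym v u sM); ring. Qed.

Lemma bilD_mx M M' (a : R) u v :
  bil (fun p q => M p q + a * M' p q) u v = bil M u v + a * bil M' u v.
Proof.
rewrite /bil !mulr_sumr -big_split; apply: eq_bigr => p _ /=.
by rewrite !mulr_sumr -big_split; apply: eq_bigr => q _ /=; ring.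
Qed.

Lemma bil_unitl M p v : bil M (unitv p) v = \sum_q M p q * v q.
Proof.
rewrite /bil (bigD1 p) //= [X in _ + X]big1 ?addr0 => [|q qp].
  by apply: eq_bigr => q _; rewrite /unitv eqxx mul1r.
by apply: big1 => r _; rewrite /unitv (negPf qp) !mul0r.
Qed.

Lemma bil_unit M p q : bil M (unitv p) (unitv q) = M p q.
Proof.
rewrite bil_unitl (bigD1 q) //= big1 ?addr0 /unitv ?eqxx ?mulr1 // => r rq.
by rewrite (negPf rq) mulr0.
Qed.

(** The vector [c * u - b * v] is orthogonal to [x], so the form is nonpositive on it. Multiplied by
    [bil M u u] and completed to a square, this is the claim times [b ^+ 2]; [b] is nonzero because
    [u], having a positive value, is not orthogonal to [x]. *)
Lemma lorentzian_crit M x : (forall p q, M p q = M q p) -> 0 < bil M x x ->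
  (forall v, bil M x v = 0 -> bil M v v <= 0) -> lorentzian M.
Proof.
move=> sM x_gt0 neg u v u_gt0.
have xu_neq0 : bil M x u != 0.
  by apply/eqP => /neg; rewrite leNgt u_gt0.
set b := bil M x u in xu_neq0; set c := bil M x v.
have /neg : bil M x (fun p => c * u p + - b * v p) = 0.
  by rewrite bilDr -/b -/c; ring.
rewrite bil_quadD //; set U := bil M u u in u_gt0 *; set W := bil M v v.
set B := bil M u v => le0.
have b2 : 0 < b ^+ 2 by rewrite exprn_even_gt0.
rewrite -subr_ge0 -(pmulr_rge0 _ b2).
have : U * (c ^+ 2 * U + 2 * c * - b * B + (- b) ^+ 2 * W) <= 0.
  by rewrite pmulr_rle0.
have := sqr_ge0 (c * U - b * B); nra.
Qed.

(* On the hyperplane orthogonal to [C e_i = B e_j] the form [B] is negative, and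
   completing the square bounds the positive part of [A] by the negative part
   of [w B]. *)
Lemma lorentzian_add A B (w : R) i j : 0 <= w ->
  (forall p q, A p q = A q p) -> (forall p q, B p q = B q p) ->
  lorentzian A -> (forall v, B j j * bil B v v <= bil B (unitv j) v ^+ 2) ->
  (forall q, A i q + w * B i q = B j q) ->
  0 < A i i -> 0 < B j j -> 0 <= A i j -> 0 <= B i j -> 0 <= B i i ->
  lorentzian (fun p q => A p q + w * B p q).
Proof.
move=> w0 sA sB lA lB eC Aii Bjj Aij Bij Bii.
have sC p q : A p q + w * B p q = A q p + w * B q p by rewrite sA sB.
apply: (@lorentzian_crit _ (unitv i)) => // [|v].
  by rewrite bil_unit ltr_wpDr ?mulr_ge0.
move=> Civ0.
have Bjv0 : bil B (unitv j) v = 0.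
  by rewrite -Civ0 !bil_unitl; apply: eq_bigr => q _; rewrite eC.
move: Civ0; rewrite !bilD_mx => Civ0.
have := lA (unitv i) v; rewrite bil_unit => /(_ Aii).
set a := bil A v v; set b := bil B (unitv i) v in Civ0 *.
(* This [s] minimizes [s ^+ 2 * A i i - 2 * s * (w * b)], the upper bound for [w * c] that [h4]
   provides. *)
set s := w * b / A i i.
have := lB (fun p => 1 * v p + s * unitv i p).
rewrite bil_quadD // bilDr Bjv0 (bil_sym v _ sB) -/b !bil_unit (sB j i).
have := eC i; have := eC j; rewrite (sB j i).
set c := bil B v v; set z := bil A _ v in Civ0 *.
have zE : z = - (w * b) by apply/eqP; rewrite -addr_eq0; apply/eqP.
rewrite zE => e1 e2 h2 h1.
have sE : s * A i i = w * b by rewrite /s mulfVK ?gt_eqF.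
(* [e1] gives [w * B i j <= B j j], and by [e2] the bracket on the right is [B i j]. *)
have h3 : w * B i j ^+ 2 <= B j j * (A i i + w * B i i).
  rewrite -e1 e2 expr2 mulrA; apply: ler_wpM2r => //; lra.
have h4 : B j j * (w * c + 2 * s * (w * b)) <= B j j * (s ^+ 2 * A i i).
  have h2' := ler_wpM2l w0 h2.
  have := ler_wpM2l (sqr_ge0 s) h3; nra.
rewrite ler_pM2l // -sE in h4.
rewrite -(pmulr_rle0 _ Aii).
move: h1; rewrite sqrrN -sE => h1.
have -> : A i i * (a + w * c) = A i i * a + A i i * (w * c) by ring.
have := ler_wpM2l (ltW Aii) h4; nra.
Qed.

End QuadraticForms.

(** * Adding an edge to a network *)

Section Push.
Variables (R : realFieldType) (V : finType).
Local Notation state := {ffun V -> nat}.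
Implicit Types (c : state -> R) (g : state) (i j p q : V) (w : R).

Definition unit_state i : state := [ffun v => nat_of_bool (v == i)].
Local Notation "''u_' i" := (unit_state i) (at level 8, i at level 2).

Lemma state_addE g g' v : (g + g') v = (g v + g' v)%N.
Proof. by rewrite ffunE. Qed.

Definition stateE := (state_addE, @ffunE).

(** The subtraction is truncated, but [push] only uses [t <= g j]. *)
Definition move_units i j t g : state :=
  [ffun v => if v == j then (g v - t)%N else (g v + t * (v == i))%N].

(* The effect on weighted flow counts, as functions of the netflow, of a new
   edge from [i] to [j] of weight [w]; [t] is the flow on that edge. *)
Definition push i j w c g : R :=
  \sum_(t < (g j).+1) w ^+ t * c (move_units i j t g).

Lemma push0 i j w c g : g j = 0%N -> push i j w c g = c g.
Proof.
move=> gj0; rewrite /push gj0 big_ord1 expr0 mul1r; congr c.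
by apply/ffunP => v; rewrite stateE mul0n addn0 subn0; case: ifP.
Qed.

(** Either the new edge carries nothing, or removing one of its units costs a factor [w] and turns a
    unit at [j] into a unit at [i]. *)
Lemma pushD i j w c g : i != j ->
  push i j w c (g + 'u_j) = c (g + 'u_j) + w * push i j w c (g + 'u_i).
Proof.
move=> ij; rewrite /push.
have -> : ((g + 'u_j)%R j).+1 = (g j).+2 by rewrite !stateE eqxx; lia.
have -> : ((g + 'u_i)%R j).+1 = (g j).+1.
  by rewrite !stateE [j == i]eq_sym (negPf ij); lia.
rewrite big_ord_recl expr0 mul1r mulr_sumr; congr (c _ + _).
  by apply/ffunP => v; rewrite stateE mul0n addn0 subn0; case: ifP.
apply: eq_bigr => t _; rewrite exprS -mulrA; congr (_ * (_ * c _)).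
apply/ffunP => v; rewrite !stateE /= /bump leq0n.
case: (eqVneq v j) => [->|vj].
  by rewrite [j == i]eq_sym (negPf ij); lia.
by case: (eqVneq v i) => _; lia.
Qed.

Definition hess c g p q : R := c (g + 'u_p + 'u_q).

Lemma hess_sym c g p q : hess c g p q = hess c g q p.
Proof. by rewrite /hess addrAC. Qed.

(* [hess c g] is the Hessian of the derivative of order [g] of the normalized
   generating function [sum_h c h x^h / h!] at [0]: for homogeneous [c] this is
   the denormalized Lorentzian property, with full support. *)
Definition dlorentzian c := (forall g, 0 < c g) /\ (forall g, lorentzian (hess c g)).

Lemma push_gt0 i j w c g : 0 <= w -> (forall g, 0 < c g) ->
  0 < push i j w c g.
Proof.
move=> w0 c0; rewrite /push big_ord_recl expr0 mul1r ltr_wpDr //.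
by apply: sumr_ge0 => t _; rewrite mulr_ge0 ?exprn_ge0 // ltW.
Qed.

(** Induction on the number of units at [j]. By [pushD] the new matrix is the old one plus [w] times
    a new one at a state with one unit fewer at [j], which is the setting of [lorentzian_add]. *)
Lemma dlorentzian_push i j w c : i != j -> 0 <= w ->
  dlorentzian c -> dlorentzian (push i j w c).
Proof.
move=> ij w0 [c0 lc]; split=> [g|]; first exact: push_gt0.
have sc_gt0 g : 0 < push i j w c g by apply: push_gt0.
have base g : g j = 0%N -> lorentzian (hess (push i j w c) g).
  move=> gj.
  (* [B] extends the recursion [C = A + w B] to the states with no unit at [j]. *)
  pose z q := push i j w c (g + 'u_i + 'u_q).
  pose B p q := if p == j then z q else if q == j then z p else 0.
  have z_gt0 q : 0 < z q by apply: sc_gt0.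
  have z_ge0 q : 0 <= z q by apply: ltW.
  have sB p q : B p q = B q p.
    by rewrite /B; case: (eqVneq p j) => [->|pj]; case: (eqVneq q j) => // ->.
  have eC p q : hess c g p q + w * B p q = hess (push i j w c) g p q.
    rewrite /hess /B /z; case: (eqVneq p j) => [->|pj].
      by rewrite addrAC pushD // [g + 'u_q + 'u_i]addrAC.
    case: (eqVneq q j) => [->|qj].
      by rewrite pushD // [g + 'u_p + 'u_i]addrAC.
    by rewrite push0 ?mulr0 ?addr0 // !stateE gj !(eq_sym j) (negPf pj) (negPf qj).
  apply: (eq_lorentzian eC).
  apply: (lorentzian_add w0 _ sB (i := i) (j := j)) => //.
  - exact: hess_sym.
  - move=> v; rewrite bil_unitl.
    (* [B] vanishes outside row and column [j], so its form is explicit and the claim becomes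
       [0 <= (S - v j * z j) ^+ 2]. *)
    have -> : bil B v v = 2 * v j * (\sum_q B j q * v q) - v j ^+ 2 * z j.
      rewrite /bil (bigD1 j) //=.
      have -> : \sum_q v j * B j q * v q = v j * \sum_q B j q * v q.
        by rewrite mulr_sumr; apply: eq_bigr => q _; rewrite mulrA.
      have -> : \sum_(p | p != j) \sum_q v p * B p q * v q =
          \sum_(p | p != j) v j * (B j p * v p).
        apply: eq_bigr => p pj; rewrite (bigD1 j) //= big1 => [|q qj].
          by rewrite addr0 sB; ring.
        by rewrite /B (negPf pj) (negPf qj); ring.
      have SE : \sum_q B j q * v q = z j * v j + \sum_(q | q != j) B j q * v q.
        by rewrite (bigD1 j) //= {1}/B eqxx.
      by rewrite -mulr_sumr SE; ring.
    rewrite {1}/B eqxx; set S := \sum_q _.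
    by have := sqr_ge0 (S - v j * z j); nra.
  - by move=> q; rewrite eC /B eqxx /hess.
  - exact: c0.
  - by rewrite /B eqxx.
  - by apply: ltW; apply: c0.
  - by rewrite /B eqxx; case: ifP.
  - by rewrite /B; case: ifP => // _; case: ifP.
move=> g; have [k] := ubnP (g j); elim: k g => // k IH g gk.
have [gj0|gj_gt0] := posnP (g j); first exact: base.
pose g' : state := [ffun v => (g v - (v == j))%N].
have gE : g = g' + 'u_j.
  by apply/ffunP => v; rewrite !stateE; case: (eqVneq v j) => [->|_] /=; lia.
have e3 u v : g' + 'u_j + 'u_u + 'u_v = g' + 'u_u + 'u_v + 'u_j.
  by rewrite [g' + 'u_j + 'u_u]addrAC [LHS]addrAC.
have e4 u v : g' + 'u_i + 'u_u + 'u_v = g' + 'u_u + 'u_v + 'u_i.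
  by rewrite [g' + 'u_i + 'u_u]addrAC [LHS]addrAC.
pose B := hess (push i j w c) (g' + 'u_i).
have eC p q : hess c g p q + w * B p q = hess (push i j w c) g p q.
  by rewrite /B /hess gE !e3 e4 pushD.
have lB : lorentzian B.
  apply: IH; rewrite !stateE [j == i]eq_sym (negPf ij) eqxx /=; lia.
apply: (eq_lorentzian eC).
apply: (lorentzian_add w0 _ _ (i := i) (j := j)) => //.
- exact: hess_sym.
- exact: hess_sym.
- by move=> v; have := lB (unitv R j) v; rewrite bil_unit; apply; apply: sc_gt0.
- move=> q; rewrite eC /B /hess gE; congr (push i j w c (_ + _)).
  by rewrite addrAC.
- exact: c0.
- by apply: sc_gt0.
- by apply: ltW; apply: c0.
- by apply: ltW; apply: sc_gt0.
- by apply: ltW; apply: sc_gt0.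
Qed.

End Push.

Local Notation "''u_' i" := (unit_state i) (at level 8, i at level 2).

(** * Log-concave sequences *)

Section LogConcave.
Variable R : archiRealFieldType.
Implicit Types (a : nat -> R) (D k l : nat).

Definition capacity_const k : R := k.+1%:R ^+ k.+1 / k%:R ^+ k.

(** The ratios of consecutive terms decrease, so [a] lies below the geometric sequence that agrees
    with it at [k] and [k.+1]. *)
Lemma logconcave_geom a D k : (k < D)%N -> (forall l, (l <= D)%N -> 0 < a l) ->
  (forall l, (l.+2 <= D)%N -> a l * a l.+2 <= a l.+1 ^+ 2) ->
  forall l, (l <= D)%N -> a l * (a k.+1 / a k) ^+ k.+1 <= a k.+1 * (a k.+1 / a k) ^+ l.
Proof.
move=> kD a0 lc; set c := _ / _.
have ak : 0 < a k by rewrite a0 // ltnW.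
have c0 : 0 < c by rewrite divr_gt0 // a0.
have cE : c * a k = a k.+1 by rewrite /c mulfVK // gt_eqF.
have up j : (k + j.+1 <= D)%N -> a (k + j.+1)%N <= c * a (k + j)%N.
  elim: j => [|j IH] jD; first by rewrite addn1 addn0 cE.
  have /IH h : (k + j.+1 <= D)%N by lia.
  have p1 : 0 < a (k + j)%N by apply: a0; lia.
  have p2 : 0 < a (k + j.+1)%N by apply: a0; lia.
  have := lc (k + j)%N; rewrite -!addnS => /(_ jD) lcj.
  rewrite -(ler_pM2l p1); apply: (le_trans lcj).
  by have := ler_wpM2l (ltW p2) h; lra.
have dn l m : (l + m = k)%N -> c * a l <= a l.+1.
  elim: m l => [|m IH] l lm; first by move: lm; rewrite addn0 => ->; rewrite cE.
  have /IH h : (l.+1 + m = k)%N by lia.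
  have p1 : 0 < a l by apply: a0; lia.
  have p2 : 0 < a l.+1 by apply: a0; lia.
  have lcj : a l * a l.+2 <= a l.+1 ^+ 2 by apply: lc; lia.
  rewrite -(ler_pM2l p2) -expr2; apply: le_trans lcj.
  by have := ler_wpM2l (ltW p1) h; lra.
move=> l lD; case: (leqP l k) => lk.
  have [m] : exists m, (l + m = k.+1)%N by exists (k.+1 - l)%N; lia.
  elim: m l {lD} lk => [|m IH] l lk lm.
    by move: lm; rewrite addn0 => ->.
  have hl : c * a l <= a l.+1 by apply: (dn l m); lia.
  rewrite -(ler_pM2l c0) [c * (a _ * c ^+ l)]mulrCA -exprS mulrA.
  apply: (@le_trans _ _ (a l.+1 * c ^+ k.+1)).
    by rewrite ler_wpM2r // exprn_ge0 // ltW.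
  case: (ltnP l k) => h; first by apply: IH => //; lia.
  by have -> : l = k by lia.
have [m lE] : exists m, (l = k + m.+1)%N by exists (l - k.+1)%N; lia.
move: lD; rewrite lE; elim: m {l lk lE} => [|m IH] mD; first by rewrite addn1.
rewrite addnS [c ^+ (k + m.+1).+1]exprS mulrCA.
apply: (@le_trans _ _ (c * a (k + m.+1)%N * c ^+ k.+1)).
  by rewrite ler_wpM2r ?exprn_ge0 ?(ltW c0) // -addnS; apply: up; lia.
rewrite -mulrA ler_wpM2l ?(ltW c0) //; apply: IH; lia.
Qed.

Lemma geometric_sum_le D k :
  \sum_(l < D) (k.+1%:R / k.+2%:R : R) ^+ l <= k.+2%:R.
Proof.
set r : R := _ / _; have r1 : r < 1 by rewrite ltr_pdivrMr ?mul1r ?ltr_nat.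
have r0 : 0 <= r by rewrite divr_ge0.
have e : (1 - r) * k.+2%:R = 1.
  by rewrite mulrBl mul1r /r mulfVK ?pnatr_eq0 // -natrB // subSnn.
have p : 0 < 1 - r by rewrite subr_gt0.
rewrite -(ler_pM2l p) e -opprB mulNr -subrX1 opprB lerBlDr ler_wpDr //.
by rewrite exprn_ge0.
Qed.

Lemma ler_add_small (L x B : R) :
  (forall e, 0 < e -> e <= 1 -> L <= x + e * B) -> L <= x.
Proof.
move=> h; rewrite leNgt; apply/negP => xL.
(* The maximum with 1 keeps the divisor [2 * b] positive whatever the sign of [B]. *)
set b := Num.max B 1; have b1 : 1 <= b by rewrite le_max lexx orbT.
have bB : B <= b by rewrite le_max lexx.
set e := Num.min 1 ((L - x) / (2 * b)).
have b0 : 0 < 2 * b by lra.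
have e0 : 0 < e by rewrite lt_min ltr01 divr_gt0 // subr_gt0.
have e1 : e <= 1 by rewrite ge_min lexx.
have e2 : e * (2 * b) <= L - x by rewrite -ler_pdivlMr // ge_min lexx orbT.
have := h e e0 e1; have := ler_wpM2l (ltW e0) bB; lra.
Qed.

(* The optimal [t] is [k / (k + 1)] times the ratio [a_(k-1) / a_k]; for [k = 0]
   the optimum is the limit [t -> 0]. *)
Lemma capacity_logconcave a D k L : (k <= D)%N ->
  (forall l, (l <= D)%N -> 0 < a l) ->
  (forall l, (l.+2 <= D)%N -> a l * a l.+2 <= a l.+1 ^+ 2) ->
  (forall t, 0 < t -> L * t ^+ k <= \sum_(l < D.+1) a l * t ^+ l) ->
  L <= capacity_const k * a k.
Proof.
case: k => [_ a0 _ h|k kD a0 lc h].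
  rewrite /capacity_const !expr0 divr1 mul1r.
  apply: (@ler_add_small _ _ (\sum_(l < D) a l.+1)) => e e0 e1.
  have := h e e0; rewrite expr0 mulr1 big_ord_recl expr0 mulr1 => /le_trans; apply.
  rewrite lerD2l mulr_sumr; apply: ler_sum => l _.
  rewrite lift0 exprSr mulrA [leRHS]mulrC ler_wpM2r ?(ltW e0) //.
  by rewrite ler_piMr ?exprn_ile1 ?(ltW e0) // ltW // a0.
have geom := logconcave_geom kD a0 lc.
set c := a k.+1 / a k in geom.
have c0 : 0 < c by rewrite divr_gt0 // a0 // ltnW.
have ck : 0 < c ^+ k.+1 by rewrite exprn_gt0.
set r : R := k.+1%:R / k.+2%:R.
have r0 : 0 < r by rewrite divr_gt0.
have := h (r / c); rewrite divr_gt0 // => /(_ isT) hr.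
(* At [t = r / c] the geometric bound reduces the sum to [a k.+1 / c ^+ k.+1] times a geometric
   series in [r], whose limit is [k.+2]. *)
have le_sum : L * r ^+ k.+1 <= a k.+1 * k.+2%:R.
  have := ler_wpM2r (ltW ck) hr.
  rewrite expr_div_n mulrA mulfVK ?gt_eqF // => /le_trans; apply.
  apply: (@le_trans _ _ (a k.+1 * \sum_(l < D.+1) r ^+ l)).
    rewrite mulr_suml mulr_sumr; apply: ler_sum => l _.
    have -> : a l * (r / c) ^+ l * c ^+ k.+1 = a l * c ^+ k.+1 / c ^+ l * r ^+ l.
      by rewrite expr_div_n; ring.
    rewrite ler_wpM2r ?exprn_ge0 ?(ltW r0) // ler_pdivrMr ?exprn_gt0 //.
    exact: geom (ltn_ord l).
  rewrite ler_wpM2l ?geometric_sum_le // ltW // a0 //.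
have -> : capacity_const k.+1 * a k.+1 = a k.+1 * k.+2%:R / r ^+ k.+1.
  rewrite /capacity_const /r expr_div_n invf_div exprS; ring.
by rewrite ler_pdivlMr // exprn_gt0.
Qed.
End LogConcave.

(** * Log-concavity of flow counts *)

Section Gauss.
Variables (R : realFieldType) (V : finType).
Local Notation state := {ffun V -> nat}.
Variables (d : state) (e : R).
Hypotheses (e_gt0 : 0 < e) (e_le1 : e <= 1).

Definition sqdist (g : state) : int := \sum_v ((g v)%:Z - (d v)%:Z) ^+ 2.

Definition gauss (g : state) : R := e ^ sqdist g.

Lemma sqdistD g p : sqdist (g + 'u_p) = sqdist g + (2 * ((g p)%:Z - (d p)%:Z) + 1).
Proof.
rewrite /sqdist (bigD1 p) //= [in RHS](bigD1 p) //=.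
rewrite (eq_bigr (fun v => ((g v)%:Z - (d v)%:Z) ^+ 2)) => [|v vp].
  by rewrite !stateE eqxx /= PoszD; ring.
by rewrite !stateE (negPf vp) addn0.
Qed.

(** Up to a positive scalar the matrix is the rank-one form of [u] minus [1 - e ^+ 2] times the
    diagonal of the [u p ^+ 2]. Negativity on the complement of one unit vector [p0] is then a
    direct computation. *)
Lemma gauss_lorentzian g (p0 : V) : lorentzian (hess gauss g).
Proof.
pose u p := e ^ (2 * ((g p)%:Z - (d p)%:Z) + 1).
have e_neq0 : e != 0 by rewrite gt_eqF.
have u_gt0 p : 0 < u p by apply: exprz_gt0.
have g_gt0 : 0 < gauss g by apply: exprz_gt0.
have hE p q : hess gauss g p q =
    gauss g * (u p * u q * (if p == q then e ^+ 2 else 1)).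
  have uE : e ^ (2 * (((g + 'u_p)%R q)%:Z - (d q)%:Z) + 1) =
      u q * (if p == q then e ^+ 2 else 1).
    rewrite !stateE eq_sym; case: eqP => _ /=; last by rewrite addn0 mulr1.
    by rewrite PoszD -[e ^+ 2]/(e ^ 2%:Z) -expfzDr //; congr (e ^ _); ring.
  rewrite /hess /gauss !sqdistD; set X := 2 * _ + 1; set Y := 2 * _ + 1.
  by rewrite (expfzDr _ Y) // (expfzDr _ X) // uE -!mulrA.
set s := 1 - e ^+ 2.
have s01 : 0 <= s <= 1.
  by rewrite /s subr_ge0 lerBlDr lerDl sqr_ge0 andbT exprn_ile1 // ltW.
have bE (v w : V -> R) : bil (hess gauss g) v w = gauss g *
   ((\sum_p u p * v p) * (\sum_q u q * w q) - s * \sum_p (u p * v p) * (u p * w p)).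
  rewrite /bil mulrBr !mulr_suml mulr_sumr mulr_sumr mulr_sumr -sumrB.
  apply: eq_bigr => p _; rewrite (bigD1 p) //= [X in _ = _ * (_ * X) - _](bigD1 p) //=.
  rewrite hE eqxx (eq_bigr (fun q => gauss g * (u p * v p) * (u q * w q))).
    rewrite -mulr_sumr /s; ring.
  by move=> q qp; rewrite hE eq_sym (negPf qp); ring.
apply: (@lorentzian_crit _ _ _ (unitv R p0)) => [p q||v].
- exact: hess_sym.
- by rewrite bil_unit hE eqxx !mulr_gt0 // exprn_gt0.
rewrite !bE => /eqP; rewrite mulf_eq0 gt_eqF //= subr_eq0.
have sum0 (h : V -> R) : \sum_p u p * unitv R p0 p * h p = u p0 * h p0.
  rewrite (bigD1 p0) //= big1 => [|p pp]; last by rewrite /unitv (negPf pp) mulr0 mul0r.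
  by rewrite /unitv eqxx addr0 mulr1.
have := sum0 (fun=> 1).
rewrite (eq_bigr (fun p => u p * unitv R p0 p)) => [->|p _]; last by rewrite mulr1.
have u_neq0 : u p0 != 0 by rewrite gt_eqF.
rewrite mulr1 sum0 mulrCA => /eqP /(mulfI u_neq0) ->.
rewrite pmulr_rle0 // (bigD1 p0) //=; set y := u p0 * v p0.
set T := \sum_(_ | _) _; have T0 : 0 <= T by apply: sumr_ge0 => p _; exact: sqr_ge0.
case/andP: s01 => s0 s1.
have -> : s * y * (s * y) - s * (y * y + T) = - (s * ((1 - s) * y ^+ 2 + T)) by ring.
by rewrite oppr_le0 mulr_ge0 // addr_ge0 // mulr_ge0 ?sqr_ge0 // subr_ge0.
Qed.

Lemma gauss_gt0 g : 0 < gauss g.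
Proof. exact: exprz_gt0. Qed.

(** Away from [d] the squared distance is a positive integer, so the weight is at most [e]. The form
    [e * 1] matches [flowD] with a constant second function. *)
Lemma gauss_le g : (g == d)%:R <= gauss g <= (g == d)%:R + e * 1.
Proof.
rewrite mulr1 /gauss; case: eqVneq => [->|gd].
  have -> : sqdist d = 0 by rewrite /sqdist big1 // => v _; rewrite subrr expr0n.
  by rewrite expr0z lexx lerDl ltW.
have : 0 < sqdist g.
  have [v gv] : exists v, g v != d v.
    by apply/existsP; apply: contraNT gd; rewrite negb_exists => /forallP h;
       apply/eqP/ffunP => v; apply/eqP; rewrite -[_ == _]negbK h.
  rewrite /sqdist (bigD1 v) //= ltr_wpDr ?sumr_ge0 // => [p _|]; first exact: sqr_ge0.
  by rewrite exprn_even_gt0 //= subr_eq0.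
case: (sqdist g) => // -[|m] // _; rewrite add0r -exprnP.
rewrite exprn_ge0 ?(ltW e_gt0) //= exprS ler_piMr ?(ltW e_gt0) //.
by rewrite exprn_ile1 // ltW.
Qed.

End Gauss.

Section Flow.
Variables (R : archiRealFieldType) (V X : finType).
Local Notation state := {ffun V -> nat}.
Variables (src tgt : X -> V).
Implicit Types (s : seq X) (c : state -> R) (w : X -> R).

Definition flow w s c : state -> R :=
  foldr (fun x b => push (src x) (tgt x) (w x) b) c s.

Lemma dlorentzian_flow w s c : (forall x, src x != tgt x) -> (forall x, 0 <= w x) ->
  dlorentzian c -> dlorentzian (flow w s c).
Proof. by move=> st w0 dc; elim: s => //= x s; apply: dlorentzian_push. Qed.

Lemma push_le i j (y : R) c c' g : 0 <= y -> (forall g, c g <= c' g) ->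
  push i j y c g <= push i j y c' g.
Proof.
by move=> y0 cc; apply: ler_sum => t _; rewrite ler_wpM2l // exprn_ge0.
Qed.

Lemma flow_le w s c c' g : (forall x, 0 <= w x) -> (forall g, c g <= c' g) ->
  flow w s c g <= flow w s c' g.
Proof.
by move=> w0 cc; elim: s g => //= x s IH g; apply: push_le.
Qed.

Lemma flowD w s c c' (y : R) g :
  flow w s (fun g => c g + y * c' g) g = flow w s c g + y * flow w s c' g.
Proof.
elim: s g => //= x s IH g; rewrite /push mulr_sumr -big_split.
by apply: eq_bigr => t _; rewrite IH /=; ring.
Qed.

(* The point mass at [d] is the limit of the strictly positive weights [gauss],
   to which [dlorentzian_flow] applies. *)
Lemma flow_capacity w s (d g : state) p q D k L :
  (forall x, src x != tgt x) -> (forall x, 0 <= w x) -> p != q -> (k <= D)%N ->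
  let a l := flow w s (fun g => (g == d)%:R) (g + 'u_p *+ l + 'u_q *+ (D - l)) in
  (forall t, 0 < t -> L * t ^+ k <= \sum_(l < D.+1) a l * t ^+ l) ->
  L <= capacity_const R k * a k.
Proof.
move=> st w0 pq kD a hL.
set T := capacity_const R k.
have T0 : 0 <= T by rewrite divr_ge0 // exprn_ge0.
pose pt l := g + 'u_p *+ l + 'u_q *+ (D - l).
apply: (@ler_add_small _ _ _ (T * flow w s (fun=> 1) (pt k))) => e e0 e1.
pose b l := flow w s (gauss d e) (pt l).
have lb : dlorentzian (flow w s (gauss d e)).
  apply: dlorentzian_flow => //; split=> [h|h]; first exact: gauss_gt0.
  exact: gauss_lorentzian.
have ab l : a l <= b l <= a l + e * flow w s (fun=> 1) (pt l).
  rewrite -flowD; apply/andP; split; apply: flow_le => // h.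
    by case/andP: (gauss_le d e0 e1 h).
  by case/andP: (gauss_le d e0 e1 h).
apply: (@le_trans _ _ (T * b k)); last first.
  rewrite [e * _]mulrCA -mulrDr ler_wpM2l //.
  by case/andP: (ab k).
apply: (@capacity_logconcave _ b D) => // [l _|l lD|t t0].
- exact: lb.1.
(* Log-concavity at [l] is the Lorentzian inequality for the unit vectors [p] and [q], at the state
   with two units removed at [q]: the entries [(p,p)], [(p,q)], [(q,q)] are [b l.+2], [b l.+1],
   [b l]. *)
- have := lb.2 (g + 'u_p *+ l + 'u_q *+ (D - l.+2)) (unitv R p) (unitv R q).
  rewrite !bil_unit /hess => /(_ (lb.1 _)); rewrite mulrC.
  have e2 : (D - l = (D - l.+2).+2)%N by lia.
  have e3 : (D - l.+1 = (D - l.+2).+1)%N by lia.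
  rewrite /b /pt e2 e3 !mulrSr !addrA.
  set x := 'u_p *+ l; set y := 'u_q *+ _.
  have -> : g + x + y + 'u_p + 'u_p = g + x + 'u_p + 'u_p + y.
    by rewrite [g + x + y + 'u_p]addrAC [LHS]addrAC.
  by rewrite [g + x + y + 'u_p]addrAC.
apply: (le_trans (hL t t0)); apply: ler_sum => l _.
by rewrite ler_wpM2r ?exprn_ge0 ?(ltW t0) //; case/andP: (ab l).
Qed.

End Flow.

(** * Flow counts as sums over tables *)

Section Expansion.
Variables (R : archiRealFieldType) (V X : finType) (M : nat).
Local Notation state := {ffun V -> nat}.
Local Notation table := {ffun X -> 'I_M.+1}.
Implicit Types (s : seq X) (a : table).

Definition supported s a := [forall x, (x \notin s) ==> (a x == ord0)].

Definition upd a x (t : 'I_M.+1) : table := [ffun y => if y == x then t else a y].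

Lemma supported_out s a x : supported s a -> x \notin s -> a x = ord0.
Proof. by move=> /forallP /(_ x) /implyP h /h /eqP. Qed.

Lemma sum_supported_nil (F : table -> R) :
  \sum_(a | supported [::] a) F a = F [ffun=> ord0].
Proof.
apply: big_pred1 => a; apply/forallP/eqP => [h|-> x]; last by rewrite ffunE eqxx.
by apply/ffunP => x; rewrite ffunE; apply/eqP/(implyP (h x)).
Qed.

Lemma sum_supported_cons (F : table -> R) x s : x \notin s ->
  \sum_(a | supported (x :: s) a) F a =
  \sum_(t < M.+1) \sum_(a | supported s a) F (upd a x t).
Proof.
move=> xs; rewrite (partition_big (fun a => a x) predT) //=.
apply: eq_bigr => t _.
rewrite (reindex_onto (fun a => upd a x t) (fun a => upd a x ord0)) /=.
  apply: eq_bigl => a; apply/idP/idP => [/andP[/andP[h1 _] /eqP h3]|h].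
    apply/forallP => y; apply/implyP => ys; rewrite -h3 ffunE.
    case: (eqVneq y x) => // yx.
    by rewrite (supported_out h1) // inE negb_or yx.
  rewrite -andbA; apply/and3P; split.
  - apply/forallP => y; rewrite inE negb_or ffunE; apply/implyP => /andP[/negPf -> ys].
    by rewrite (supported_out h ys).
  - by rewrite ffunE eqxx.
  - apply/eqP/ffunP => y; rewrite !ffunE; case: eqP => // ->.
    by rewrite (supported_out h xs).
move=> a /andP[_ /eqP ax]; apply/ffunP => y; rewrite !ffunE.
by case: eqP => // ->.
Qed.

Variables (src tgt : X -> V).

(** Outflow of [a] at each vertex when [f] is [src], inflow when [f] is [tgt]. Conservation is
    written as an equality of two sums, to stay within natural numbers. *)
Definition shift (f : X -> V) a : state := \sum_x 'u_(f x) *+ a x.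

Lemma unit_state_mulnE (i : V) t v : ('u_i *+ t) v = (t * (v == i))%N.
Proof. by elim: t => [|t IH]; rewrite ?mulr0n ?mulrS ?state_addE ?IH !ffunE //; lia. Qed.

Lemma shift_upd f a x t : a x = ord0 -> shift f (upd a x t) = 'u_(f x) *+ t + shift f a.
Proof.
move=> ax; rewrite /shift (bigD1 x) //= [in RHS](bigD1 x) //= ffunE eqxx ax mulr0n add0r.
by congr (_ + _); apply: eq_bigr => y yx; rewrite ffunE (negPf yx).
Qed.

Lemma shift_notin f a v : (forall x, f x != v) -> shift f a v = 0%N.
Proof.
move=> fv; rewrite /shift sum_ffunE big1 // => x _.
by rewrite unit_state_mulnE eq_sym (negPf (fv x)) muln0.
Qed.

(** Unfolds one edge at a time. No vertex is both a source and a target, so an edge carries at most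
    what its target holds, and the cap [M] loses no flow. *)
Lemma flow_expand (w : X -> R) s (d g : state) : uniq s ->
  (forall x y, src x != tgt y) -> (forall x, d (tgt x) = 0%N) ->
  (forall x, g (tgt x) <= M)%N ->
  flow src tgt w s (fun g => (g == d)%:R) g =
  \sum_(a | supported s a)
     (\prod_x w x ^+ a x) * (g + shift src a == d + shift tgt a)%:R.
Proof.
move=> us st d0; elim: s us g => [_ g gM|x s IH /andP[xs us] g gM] /=.
  rewrite sum_supported_nil big1 ?mul1r => [|x _]; last by rewrite ffunE expr0.
  have h f : shift f [ffun=> ord0] = 0 by rewrite /shift big1 // => x _; rewrite ffunE mulr0n.
  by rewrite !h !addr0.
rewrite sum_supported_cons // /push.
have gMx : ((g (tgt x)).+1 <= M.+1)%N by rewrite ltnS.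
rewrite (big_ord_widen _ (fun t : nat => w x ^+ t *
  flow src tgt w s _ (move_units (src x) (tgt x) t g)) gMx).
rewrite [in LHS]big_mkcond /=; apply: eq_bigr => t _; case: ltnP => [tg|gt].
  rewrite IH // => [|y]; last first.
    rewrite ffunE; case: eqP => [->|_]; first exact: leq_trans (leq_subr _ _) (gM x).
    by rewrite eq_sym (negPf (st _ _)) muln0 addn0.
  rewrite mulr_sumr; apply: eq_bigr => a sa.
  have ax := supported_out sa xs.
  rewrite !shift_upd // mulrA; congr (_ * _).
    rewrite (bigD1 x) //= [in RHS](bigD1 x) //= ffunE eqxx ax expr0 mul1r.
    by congr (_ * _); apply: eq_bigr => y yx; rewrite ffunE (negPf yx).
  congr (nat_of_bool _)%:R; set o := shift src a; set n := shift tgt a.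
  have ij := st x x.
  apply/eqP/eqP => /ffunP h; apply/ffunP => v; have := h v;
    rewrite !state_addE !unit_state_mulnE !ffunE; case: (eqVneq v (tgt x)) => [->|vt];
    rewrite ?[tgt x == src x]eq_sym ?(negPf ij); lia.
(* An edge value above the content of its target violates conservation at that target, so these
   terms vanish. *)
rewrite big1 // => a sa; rewrite !shift_upd ?(supported_out sa xs) //.
case: eqP => [/ffunP /(_ (tgt x))|]; last by rewrite mulr0.
rewrite !state_addE !unit_state_mulnE eqxx d0 eq_sym (negPf (st x x)) shift_notin => [|y];
  last exact: st.
lia.
Qed.

End Expansion.

(** * Row extraction *)

Section Tfun.
Variable R : realType.
Implicit Types (x z : R).

Lemma Tfun_gt0 x : 0 <= x -> 0 < Tfun x.
Proof.
move=> x0; rewrite /Tfun divr_gt0 //; first by apply: powR_gt0; rewrite ltr_wpDl.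
move: x0; rewrite le_eqVlt => /predU1P[<-|x0]; last exact: powR_gt0.
by rewrite powRr0.
Qed.

Lemma Tfun0 : Tfun (0 : R) = 1.
Proof. by rewrite /Tfun add0r powR1 powRr0 divr1. Qed.

Lemma Tfun_nat k : Tfun (k%:R : R) = capacity_const R k.
Proof.
by rewrite /Tfun /capacity_const -natr1 natr1 !powR_mulrn // ?ler0n.
Qed.

(** For fixed [x] the maximum of [(1 - z) * z ^ x] is at [z = x / (x + 1)]. After taking logarithms
    it suffices to apply [ln u <= u - 1] to [z * (x + 1) / x] and to [(1 - z) * (x + 1)]: the two
    upper bounds cancel. *)
Lemma Tfun_geometric_le z x : 0 <= x -> 0 < z -> z < 1 ->
  Tfun x * (1 - z) * z `^ x <= 1.
Proof.
rewrite le_eqVlt => /predU1P[<-|x0] z0 z1.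
  by rewrite Tfun0 powRr0 mulr1 mul1r; lra.
have x1 : 0 < x + 1 by lra.
have z1' : 0 < 1 - z by lra.
have ln_le (u : R) : 0 < u -> ln u <= u - 1.
  by move=> u0; have := @le_ln1Dx _ (u - 1); rewrite [1 + _]addrC subrK; apply; lra.
have -> : Tfun x * (1 - z) * z `^ x = expR (x * (ln z + ln (x + 1) - ln x) +
    (ln (1 - z) + ln (x + 1))).
  have -> : x * (ln z + ln (x + 1) - ln x) + (ln (1 - z) + ln (x + 1)) =
      (x + 1) * ln (x + 1) + - (x * ln x) + ln (1 - z) + x * ln z by ring.
  by rewrite /Tfun /powR !gt_eqF // !expRD expRN (lnK (x := 1 - z)) ?posrE.
rewrite -[leRHS]expR0 ler_expR.
have -> : ln z + ln (x + 1) - ln x = ln (z * (x + 1) / x).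
  by rewrite ln_div ?lnM ?posrE // mulr_gt0.
have -> : ln (1 - z) + ln (x + 1) = ln ((1 - z) * (x + 1)) by rewrite lnM ?posrE.
have h1 := ln_le (z * (x + 1) / x) (divr_gt0 (mulr_gt0 z0 x1) x0).
have h2 := ln_le ((1 - z) * (x + 1)) (mulr_gt0 z1' x1).
apply: (le_trans (lerD (ler_wpM2l (ltW x0) h1) h2)).
have -> : x * (z * (x + 1) / x - 1) = z * (x + 1) - x by field; rewrite gt_eqF.
lra.
Qed.

End Tfun.

(** * Complete homogeneous symmetric polynomials: log-concavity and generating series *)

Section HomogeneousSums.
Import numFieldNormedType.Exports.
Local Open Scope classical_set_scope.
Local Open Scope ring_scope.
Variable R : realType.
Implicit Types (ys : seq R) (y x : R).

(* Complete homogeneous symmetric polynomial of degree [l] in [ys]. *)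
Fixpoint hsum ys l : R :=
  if ys is y :: ys' then \sum_(t < l.+1) y ^+ t * hsum ys' (l - t)%N else (l == 0%N)%:R.

Lemma hsum_degree0 ys : hsum ys 0 = 1.
Proof. by elim: ys => //= y ys IH; rewrite big_ord1 expr0 mul1r. Qed.

Lemma hsum_cons y ys l :
  hsum (y :: ys) l = \sum_(t < l.+1) y ^+ t * hsum ys (l - t)%N.
Proof. by []. Qed.

Lemma hsum_consS y ys l : hsum (y :: ys) l.+1 = hsum ys l.+1 + y * hsum (y :: ys) l.
Proof.
rewrite !hsum_cons big_ord_recl expr0 mul1r; congr (_ + _).
by rewrite mulr_sumr; apply: eq_bigr => t _; rewrite exprS mulrA.
Qed.

Lemma hsum_ge0 ys l : all (fun y => 0 <= y) ys -> 0 <= hsum ys l.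
Proof.
elim: ys l => [|u us IHu] l /=; first by rewrite ler0n.
by case/andP=> u0 us0; apply: sumr_ge0 => t _; rewrite mulr_ge0 ?exprn_ge0 ?IHu.
Qed.

(** Multiplication by [y] sends the monomials of degree [l] injectively to monomials of degree
    [l.+1]. *)
Lemma hsum_succ_ge ys y l : all (fun y => 0 <= y) ys -> y \in ys ->
  y * hsum ys l <= hsum ys l.+1.
Proof.
elim: ys l => //= x ys IH l /andP[x0 ys0]; rewrite inE => /predU1P[->|yys].
  by have := hsum_consS x ys l; rewrite /= => ->; rewrite lerDr hsum_ge0.
rewrite [leRHS]big_ord_recr /= ler_wpDr ?mulr_ge0 ?exprn_ge0 ?hsum_ge0 //.
rewrite mulr_sumr; apply: ler_sum => t _; rewrite mulrCA ler_wpM2l ?exprn_ge0 //.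
by rewrite subSn ?IH // -ltnS.
Qed.

(** Induction on the variables by [hsum_consS], together with the comparison [pq]: adding a variable
    does not decrease the ratios of consecutive terms. *)
Lemma hsum_logconcave y ys : 0 < y -> all (fun y => 0 < y) ys ->
  (forall l, 0 < hsum (y :: ys) l) /\
  (forall l, hsum (y :: ys) l * hsum (y :: ys) l.+2 <= hsum (y :: ys) l.+1 ^+ 2).
Proof.
elim: ys y => [|x ys IH] y y0.
  have h l : hsum [:: y] l = y ^+ l.
    elim: l => [|l IH]; first by rewrite hsum_degree0.
    by rewrite hsum_consS IH /= add0r exprS.
  move=> _; split=> l; rewrite !h ?exprn_gt0 // -!exprD -exprM.
  by rewrite (_ : (l + l.+2 = l.+1 * 2)%N) //; lia.
case/andP=> /IH{}IH /IH []; set p := hsum (x :: ys) => p0 plc.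
set q := hsum (y :: x :: ys).
have q0E : q 0%N = p 0%N by rewrite /q /p !hsum_degree0.
have qS l : q l.+1 = p l.+1 + y * q l by apply: hsum_consS.
have q0 l : 0 < q l.
  by elim: l => [|l IHl]; rewrite ?q0E // qS addr_gt0 // mulr_gt0.
(* The conclusion of [key] serves twice: it drives the induction for [pq], and it is what remains of
   the log-concavity of [q] once its recursion is substituted. *)
have key l : p l.+1 * q l <= p l * q l.+1 -> p l.+2 * q l <= p l.+1 * q l.+1.
  move=> h; rewrite -(ler_pM2l (p0 l)).
  have h1 := ler_wpM2r (ltW (q0 l)) (plc l).
  have h2 := ler_wpM2l (ltW (p0 l.+1)) h; lra.
have pq l : p l.+1 * q l <= p l * q l.+1.
  elim: l => [|l IHl].
    by rewrite qS q0E mulrDr [_ * p 1]mulrC lerDl !mulr_ge0 ?(ltW (p0 _)) // ltW.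
  have -> : p l.+2 * q l.+1 = p l.+1 * p l.+2 + y * (p l.+2 * q l) by rewrite qS; ring.
  by have := ler_wpM2l (ltW y0) (key _ IHl); rewrite [q l.+2]qS; lra.
split=> // l.
have -> : q l.+1 ^+ 2 = p l.+1 * q l.+1 + y * q l * q l.+1 by rewrite expr2 {1}qS; ring.
by have := key _ (pq l); rewrite [q l.+2]qS; lra.
Qed.

Lemma ler_geometric_limit (x p r : R) : 0 <= x < 1 ->
  (forall m, p * (1 - x ^+ m) <= r) -> p <= r.
Proof.
case/andP=> x0 x1 h; have [p0|p0] := leP p 0.
  by have := h 0%N; rewrite expr0 subrr mulr0; apply: le_trans.
have xm : (fun m => x ^+ m) @ \oo --> (0 : R).
  by apply: cvg_expr; rewrite ger0_norm.
have cv : (fun m => p * (1 - x ^+ m)) @ \oo --> p * (1 - 0).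
  by apply: cvgMr; apply: cvgB => //; exact: cvg_cst.
rewrite -[p]mulr1 -[1]subr0 -(cvg_lim _ cv) //.
by apply: limr_le; [apply/cvg_ex; exists (p * (1 - 0))|exact: nearW].
Qed.

(* [prod 1 / (1 - x y)] is the limit of the partial sums of the generating
   series, one factor at a time. *)
Lemma hsum_series_ge ys x (Y : R) : 0 <= x ->
  all (fun y => 0 <= y) ys -> all (fun y => x * y < 1) ys ->
  (forall n, \sum_(l < n) hsum ys l * x ^+ l <= Y) -> 1 <= Y * \prod_(y <- ys) (1 - x * y).
Proof.
move=> x0; elim: ys Y => [|y ys IH] Y.
  by move=> _ _ /(_ 1%N); rewrite big_ord1 expr0 mulr1 big_nil mulr1.
move=> /andP[y0 ys0] /andP[xy ysx] h; rewrite big_cons mulrA; apply: IH => // n.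
set P := \sum_(l < n) _; set z := x * y in xy *.
have z0 : 0 <= z by rewrite mulr_ge0.
pose Q n := \sum_(l < n) hsum (y :: ys) l * x ^+ l.
have QS m : Q m.+1 = \sum_(l < m.+1) hsum ys l * x ^+ l + z * Q m.
  rewrite /Q big_ord_recl [in RHS]big_ord_recl !hsum_degree0 -addrA; congr (_ + _).
  rewrite [in RHS]mulr_sumr -[RHS]big_split; apply: eq_bigr => l _.
  by rewrite !lift0 hsum_consS exprS /z /=; ring.
have S_le m : P <= \sum_(l < (n + m).+1) hsum ys l * x ^+ l.
  rewrite /P -!(big_mkord predT (fun l => hsum ys l * x ^+ l)).
  rewrite [leRHS](big_cat_nat (n := n)) //= ?lerDl ?sumr_ge0 ?(leqW (leq_addr _ _)) // => l _.
  by rewrite mulr_ge0 ?exprn_ge0 ?hsum_ge0.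
(* Iterates [Q m.+1 >= P + z * Q m], valid from index [n] on; [m] steps give a truncated geometric
   series in [z]. *)
have Qge m : P * (1 - z ^+ m) <= (1 - z) * Q (n + m)%N.
  elim: m => [|m IHm].
    rewrite expr0 subrr mulr0; apply: mulr_ge0; first by rewrite subr_ge0 ltW.
    by apply: sumr_ge0 => l _; rewrite mulr_ge0 ?exprn_ge0 ?hsum_ge0 //= y0.
  rewrite addnS QS exprS.
  have h1 := ler_wpM2l z0 IHm.
  have z1 : 0 <= 1 - z by rewrite subr_ge0 ltW.
  have h2 := ler_wpM2l z1 (S_le m); lra.
apply: (@ler_geometric_limit z) => [|m]; first by rewrite z0.
apply: (le_trans (Qge m)); rewrite [leRHS]mulrC ler_wpM2l ?h //.
by rewrite subr_ge0 ltW.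
Qed.

End HomogeneousSums.

Lemma prod_powR (R : realType) (X : Type) (s : seq X) (x : R) (a : X -> R) :
  0 < x -> \prod_(j <- s) x `^ a j = x `^ (\sum_(j <- s) a j).
Proof.
move=> x0; elim: s => [|j s IH]; first by rewrite !big_nil powRr0.
by rewrite !big_cons IH powRD //; apply/implyP => _; rewrite gt_eqF.
Qed.

(** * The lower bound for one row *)

Section RowBound.
Variables (R : realType) (X : eqType).
Implicit Types (a y : X -> R).

(** Evaluates the generating series at the [x] used for log-concave sequences: [hsum_series_ge]
    bounds the product of the [1 - x * y j] below by [1 / Y], and [Tfun_geometric_le] bounds each
    factor on the left times [x ^ a j * (1 - x * y j)] by 1. *)
Lemma hsum_capacity (s : seq X) y a k : (forall j, 0 < y j) ->
  (forall j, 0 <= a j) -> \sum_(j <- s) a j = k%:R ->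
  \prod_(j <- s) (Tfun (a j) * y j `^ a j) <= capacity_const R k * hsum (map y s) k.
Proof.
move=> y0 a0; case: k => [|k] ak.
  rewrite hsum_degree0 -Tfun_nat Tfun0 mulr1 big_seq big1 // => j js.
  have -> : a j = 0.
    apply/eqP; rewrite eq_le a0 andbT -[leRHS]/(0%:R) -ak (big_rem j) //= lerDl.
    by apply: sumr_ge0 => i _.
  by rewrite Tfun0 powRr0 mulr1.
have [lp lc] : (forall l, 0 < hsum (map y s) l) /\
    (forall l, hsum (map y s) l * hsum (map y s) l.+2 <= hsum (map y s) l.+1 ^+ 2).
  case: s ak => [|j s] ak.
    by move/eqP: ak; rewrite big_nil eq_sym pnatr_eq0.
  by apply: hsum_logconcave => //; apply/allP => _ /mapP[i _ ->].
have ys0 : all (fun u => 0 <= u) (map y s) by apply/allP => _ /mapP[i _ ->]; exact: ltW.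
set h := hsum (map y s) in lp lc *; set c := h k.+1 / h k.
have c0 : 0 < c by rewrite divr_gt0.
have ck0 : 0 < c ^+ k.+1 by rewrite exprn_gt0.
have geom l : h l * c ^+ k.+1 <= h k.+1 * c ^+ l.
  by apply: (@logconcave_geom _ h (maxn l k.+1)) => //; rewrite leq_max ?leqnn ?orbT.
set r : R := k.+1%:R / k.+2%:R.
have r0 : 0 < r by rewrite divr_gt0.
have r1 : r < 1 by rewrite ltr_pdivrMr ?mul1r ?ltr_nat.
set x := r / c; have x0 : 0 < x by rewrite divr_gt0.
(* By [hsum_succ_ge] every [y j] is at most the ratio [c], so [x * y j <= r]. *)
have xy1 j : j \in s -> x * y j < 1.
  move=> js; apply: le_lt_trans r1; rewrite /x mulrAC ler_pdivrMr // ler_wpM2l ?(ltW r0) //.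
  by rewrite ler_pdivlMr // hsum_succ_ge // map_f.
set Y := h k.+1 * k.+2%:R / c ^+ k.+1.
have := @hsum_series_ge _ (map y s) x Y (ltW x0) ys0.
rewrite big_map => /(_ _ _) hY.
have {}hY : 1 <= Y * \prod_(j <- s) (1 - x * y j).
  apply: hY => [|n]; first by apply/allP => _ /mapP[i si ->]; exact: xy1.
  rewrite /Y -mulrA mulrCA mulrC.
  apply: le_trans (ler_wpM2l _ (geometric_sum_le R n k)); last first.
    by rewrite divr_ge0 // ltW.
  rewrite mulr_sumr; apply: ler_sum => l _.
  rewrite /x expr_div_n -/r mulrA mulrAC ler_wpM2r ?exprn_ge0 ?(ltW r0) //.
  by rewrite ler_pdivrMr ?exprn_gt0 // mulrAC ler_pdivlMr.
set P := \prod_(j <- s) (1 - _) in hY.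
have P0 : 0 < P.
  by rewrite /P big_seq; apply: prodr_gt0 => j js; rewrite subr_gt0 xy1.
have prod_le1 : \prod_(j <- s) (Tfun (a j) * y j `^ a j) * x ^+ k.+1 * P <= 1.
  rewrite -(powR_mulrn _ (ltW x0)) -ak -prod_powR // -!big_split big_seq /=.
  apply: prodr_ile1 => j js; have z0 : 0 < x * y j by rewrite mulr_gt0.
  have -> : Tfun (a j) * y j `^ a j * x `^ a j * (1 - x * y j) =
      Tfun (a j) * (1 - x * y j) * (x * y j) `^ a j.
    by rewrite powRM ?(ltW x0) ?(ltW (y0 j)) //; ring.
  apply/andP; split; last by apply: Tfun_geometric_le => //; apply: xy1.
  apply: mulr_ge0; last exact: powR_ge0.
  apply: mulr_ge0; first exact: ltW (Tfun_gt0 (a0 j)).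
  by rewrite subr_ge0 ltW // xy1.
have := le_trans prod_le1 hY; rewrite ler_pM2r // -ler_pdivlMr ?exprn_gt0 //.
have -> // : Y / x ^+ k.+1 = capacity_const R k.+1 * h k.+1.
rewrite /Y /x /capacity_const (expr_div_n r c) /r (expr_div_n _ k.+2%:R) [k.+2%:R ^+ k.+2]exprS.
have := expf_neq0 k.+1 (negbT (gt_eqF (ltr0Sn R k))).
have := expf_neq0 k.+1 (negbT (gt_eqF (ltr0Sn R k.+1))).
move: ck0; move: (_ ^+ _) => u u0; move: (_ ^+ _) => v v0; move: (_ ^+ _) => z z0.
by field; rewrite z0 v0 gt_eqF.
Qed.
End RowBound.

Section HsumExpand.
Variables (R : realType) (X : finType) (M : nat).

(** An exponent never exceeds the degree [k], so capping exponents at [M] keeps all monomials. *)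
Lemma hsum_expand (y : X -> R) (s : seq X) k : uniq s -> (k <= M)%N ->
  hsum (map y s) k =
  \sum_(a : {ffun X -> 'I_M.+1} | supported s a && (\sum_x (a x : nat) == k)%N)
     \prod_x y x ^+ a x.
Proof.
move=> us; rewrite [RHS]big_mkcondr /=.
elim: s us k => [_ k kM|x s IH /andP[xs us] k kM].
  rewrite sum_supported_nil /= big1 => [|x _]; last by rewrite ffunE.
  rewrite eq_sym; case: eqP => // _; rewrite big1 // => x _.
  by rewrite ffunE expr0.
have kM1 : (k.+1 <= M.+1)%N by [].
rewrite map_cons hsum_cons sum_supported_cons //.
rewrite (big_ord_widen _ (fun t : nat => y x ^+ t * hsum (map y s) (k - t)%N) kM1).
rewrite [in LHS]big_mkcond /=; apply: eq_bigr => t _.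
have sumE a : supported s a ->
    (\sum_z (upd a x t z : nat))%N = (t + \sum_z (a z : nat))%N.
  move=> sa; rewrite (bigD1 x) //= [in RHS](bigD1 x) //= ffunE eqxx.
  rewrite (supported_out sa xs) add0n; congr (_ + _)%N.
  by apply: eq_bigr => z zx; rewrite ffunE (negPf zx).
case: ltnP => [tk|kt].
  rewrite IH //; last by apply: leq_trans kM; exact: leq_subr.
  rewrite mulr_sumr; apply: eq_bigr => a sa; rewrite sumE //.
  have -> : (t + \sum_z (a z : nat) == k)%N = (\sum_z (a z : nat) == k - t)%N by lia.
  case: eqP => _; last by rewrite mulr0.
  rewrite (bigD1 x) //= [in RHS](bigD1 x) //= ffunE eqxx (supported_out sa xs).
  rewrite expr0 mul1r; congr (_ * _).
  by apply: eq_bigr => z zx; rewrite ffunE (negPf zx).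
by rewrite big1 // => a sa; rewrite sumE //; case: eqP => //; lia.
Qed.

End HsumExpand.

(** * Tables with given row sums and their column polynomials *)

Section Tables.
Variables (R : realType) (I J : finType) (M : nat) (E : I -> J -> bool).
Variables (alpha : I -> nat) (beta : J -> nat).
Local Notation table := {ffun I * J -> 'I_M.+1}.
Implicit Types (a : table) (D : {set J}) (y : J -> R).

Definition rowsum a i := (\sum_j (a (i, j) : nat))%N.
Definition colsum a j := (\sum_i (a (i, j) : nat))%N.

Definition edges : seq (I * J) := [seq e <- enum (predT : pred (I * J)) | E e.1 e.2].

Definition is_table a := supported edges a && [forall i, rowsum a i == alpha i].

Definition fixes D a := [forall j in D, colsum a j == beta j].

(** If no [alpha i] exceeds [M], this is the coefficient in [prod 1 / (1 - x_i y_j)] of all row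
    monomials and of the column monomials in [D], still a polynomial in the other column
    variables. *)
Definition colpoly D y : R :=
  \sum_(a | is_table a && fixes D a) \prod_(j | j \notin D) y j ^+ colsum a j.

Lemma supported_edges a :
  supported edges a = [forall i, forall j, ~~ E i j ==> (a (i, j) == ord0)].
Proof.
apply/forallP/forallP => [h i|h [i j]].
  by apply/forallP => j; have := h (i, j); rewrite mem_filter mem_enum andbT.
by have /forallP := h i; rewrite mem_filter mem_enum andbT; apply.
Qed.

(** With no column constraint the rows are chosen independently, so the sum factors over rows. *)
Lemma colpoly0 y : (forall i, alpha i <= M)%N ->
  colpoly finset.set0 y = \prod_i hsum (map y [seq j <- enum J | E i j]) (alpha i).
Proof.
move=> aM.
under eq_bigr => i _ do rewrite (hsum_expand _ (filter_uniq _ (enum_uniq J)) (aM i)).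
rewrite bigA_distr_big_dep /=.
rewrite (reindex (fun a : table => [ffun i => [ffun j => a (i, j)]])) /=; last first.
  exists (fun f : {ffun I -> {ffun J -> 'I_M.+1}} => [ffun e => f e.1 e.2]) => a _.
    by apply/ffunP => -[i j]; rewrite !ffunE.
  by apply/ffunP => i; apply/ffunP => j; rewrite !ffunE.
apply: eq_big => [a|a _].
  rewrite /is_table supported_edges.
  apply/andP/familyP => [[/andP[/forallP s /forallP r] _] i|h].
    rewrite unfold_in ffunE; apply/andP; split.
      apply/forallP => j; rewrite mem_filter mem_enum andbT ffunE.
      by have /forallP := s i; apply.
    by rewrite -(eqP (r i)); apply/eqP/eq_bigr => j _; rewrite ffunE.
  split; last by apply/forallP => j; rewrite inE.
  apply/andP; split; apply/forallP => i; have := h i; rewrite unfold_in ffunE => /andP[s r].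
    apply/forallP => j; have /forallP/(_ j) := s.
    by rewrite mem_filter mem_enum andbT ffunE.
  by rewrite -(eqP r); apply/eqP/eq_bigr => j _; rewrite ffunE.
under [RHS]eq_bigr => i _ do rewrite ffunE.
rewrite exchange_big /=; apply: eq_big => [j|j _]; first by rewrite inE.
by rewrite /colsum expr_sum; apply: eq_bigr => i _; rewrite ffunE.
Qed.

End Tables.

(** * Column extraction *)

Section Columns.
Variables (R : realType) (I J : finType) (M : nat) (E : I -> J -> bool).
Variables (alpha : I -> nat) (beta : J -> nat) (A : I -> J -> R).
Local Notation table := {ffun I * J -> 'I_M.+1}.
Implicit Types (a : table) (D : {set J}) (y : J -> R).
Hypothesis A_ge0 : forall i j, 0 <= A i j.
Hypothesis rowA : forall i, \sum_(j | E i j) A i j = (alpha i)%:R.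
Hypothesis colA : forall j, \sum_(i | E i j) A i j = (beta j)%:R.
Hypothesis alphaM : (\sum_i alpha i <= M)%N.

Local Notation cc := (capacity_const R).
Local Notation colpoly := (@colpoly R I J M E alpha beta).
Local Notation is_table := (@is_table I J M E alpha).
Local Notation weight := (\prod_i \prod_(j | E i j) Tfun (A i j) / \prod_i cc (alpha i)).

Lemma capacity_const_gt0 k : 0 < cc k.
Proof. by rewrite -Tfun_nat Tfun_gt0 ?ler0n. Qed.

(** [hsum_capacity] is applied to each row; the exponents of [y j] add up to [beta j] by [colA]. *)
Lemma colpoly0_ge y : (forall j, 0 < y j) ->
  weight * \prod_j y j ^+ beta j <= colpoly finset.set0 y.
Proof.
move=> y0; rewrite colpoly0 => [|i]; last first.
  by apply: leq_trans alphaM; rewrite (bigD1 i) //= leq_addr.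
rewrite mulrAC ler_pdivrMr; last by apply: prodr_gt0 => i _; exact: capacity_const_gt0.
rewrite mulrC -big_split /=.
have -> : \prod_j y j ^+ beta j = \prod_i \prod_(j | E i j) y j `^ A i j.
  rewrite (exchange_big_dep predT) //=; apply: eq_bigr => j _.
  rewrite -(powR_mulrn _ (ltW (y0 j))) -colA.
  rewrite -[X in _ `^ X]big_filter -[RHS]big_filter prod_powR //.
rewrite -big_split /=; apply: ler_prod => i _.
rewrite -big_split /= prodr_ge0 /= => [|j _]; last first.
  by rewrite mulr_ge0 ?powR_ge0 // ltW // Tfun_gt0.
have := @hsum_capacity R J [seq j <- enum J | E i j] y (A i) (alpha i) y0 (A_ge0 i).
rewrite !big_filter !big_enum_cond /= mulrC => /(_ (rowA i)); congr (_ <= _).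
by apply: eq_bigr => j _; rewrite mulrC.
Qed.

Lemma shiftE (V : finType) (f : I * J -> V) a v :
  shift f a v = (\sum_(e | f e == v) (a e : nat))%N.
Proof.
rewrite /shift sum_ffunE [RHS]big_mkcond /=.
by apply: eq_bigr => e _; rewrite unit_state_mulnE eq_sym; case: eqP; rewrite ?muln1 ?muln0.
Qed.

Lemma sum_edges (P : pred J) (F : I * J -> nat) :
  (\sum_(e | P e.2) F e = \sum_(j | P j) \sum_i F (i, j))%N.
Proof. by rewrite exchange_big pair_big /=; apply: eq_big => -[i j]. Qed.

Lemma sum_margins : (\sum_i alpha i = \sum_j beta j)%N.
Proof.
apply/eqP; rewrite -(eqr_nat R) !natr_sum; apply/eqP.
under eq_bigr => i _ do rewrite -rowA.
under [RHS]eq_bigr => j _ do rewrite -colA.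
by rewrite (exchange_big_dep predT).
Qed.

Lemma sum_colsum a : is_table a -> (\sum_i alpha i = \sum_j colsum a j)%N.
Proof.
case/andP=> _ /forallP r; rewrite /colsum exchange_big /=.
by apply: eq_bigr => i _; rewrite -(eqP (r i)).
Qed.

(* In the network used here the rows are the sources, the columns of [D] and
   [j0] are sinks of their own, and all other columns are merged into one sink,
   their variables becoming edge weights. *)
Lemma colpoly_step D j0 y (L : R) : j0 \notin D ->
  (forall z, (forall j, 0 < z j) ->
     L * \prod_(j | j \notin D) z j ^+ beta j <= colpoly D z) ->
  (forall j, 0 < y j) ->
  L * \prod_(j | j \notin j0 |: D) y j ^+ beta j <= cc (beta j0) * colpoly (j0 |: D) y.
Proof.
move=> j0D hL y0.
pose D' := j0 |: D.
pose m := (\sum_(j | j \notin D) beta j)%N.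
have sumD : (\sum_i alpha i = \sum_(j in D) beta j + m)%N.
  by rewrite sum_margins (bigID (mem D)).
pose V : finType := (I + option J)%type.
pose src (e : I * J) : V := inl e.1.
pose tgt (e : I * J) : V := inr (if e.2 \in D' then Some e.2 else None).
pose w (e : I * J) : R := if e.2 \in D' then 1 else y e.2.
pose d : {ffun V -> nat} := [ffun v => if v is inl i then alpha i else 0%N].
pose g : {ffun V -> nat} :=
  [ffun v => if v is inr (Some j) then (if j \in D then beta j else 0%N) else 0%N].
pose p : V := inr (Some j0). pose q : V := inr None.
have wE a : \prod_e w e ^+ a e = \prod_(j | j \notin D') y j ^+ colsum a j.
  have -> : \prod_e w e ^+ a e = \prod_j \prod_i w (i, j) ^+ a (i, j).
    by rewrite exchange_big pair_bigA; apply: eq_bigr => -[i j].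
  rewrite [RHS]big_mkcond /=; apply: eq_bigr => j _.
  rewrite /colsum expr_sum /w /=; case: ifP => _ //=.
  by apply: big1 => i _; rewrite expr1n.
have srcE a i : shift src a (inl i) = rowsum a i.
  rewrite shiftE; transitivity (\sum_(i' | i' == i) rowsum a i')%N.
    by rewrite pair_big /=; apply: eq_big => -[i' j] //=; rewrite andbT.
  exact: big_pred1_eq.
have src0 a v : shift src a (inr v) = 0%N by rewrite shiftE big1.
have tgt0 a i : shift tgt a (inl i) = 0%N by rewrite shiftE big1.
have tgtE a j : shift tgt a (inr (Some j)) = if j \in D' then colsum a j else 0%N.
  rewrite shiftE; case: ifP => jD'.
    rewrite (eq_bigl (fun e : I * J => e.2 == j)) => [|e].
      by rewrite (sum_edges (pred1 j)) big_pred1_eq.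
    rewrite /tgt; case: ifP => eD'; first by apply/eqP/eqP => [[->]|->].
    by apply/eqP/eqP => // ej; rewrite -ej eD' in jD'.
  apply: big1 => e; rewrite /tgt; case: ifP => // eD' /eqP[ej].
  by rewrite -ej eD' in jD'.
have tgtN a : shift tgt a q = (\sum_(j | j \notin D') colsum a j)%N.
  rewrite shiftE (eq_bigl (fun e : I * J => e.2 \notin D')); first exact: sum_edges.
  by move=> e; rewrite /tgt; case: ifP.
have j0D' : j0 \in D' by rewrite !inE eqxx.
have D'E (F : J -> nat) :
    (\sum_(j in D') F j = F j0 + \sum_(j in D) F j)%N by rewrite big_setU1.
(* [l] is the sum of column [j0]; the other [m - l] units belong to the merged sink. *)
pose G l := g + 'u_p *+ l + 'u_q *+ (m - l)%N.
have GS l j : G l (inr (Some j)) = ((if j \in D then beta j else 0) + l * (j == j0))%N.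
  by rewrite /G !state_addE !unit_state_mulnE ffunE muln0 addn0.
have GN l : G l (inr None) = (m - l)%N.
  by rewrite /G !state_addE !unit_state_mulnE ffunE muln0 eqxx muln1.
have GI l i : G l (inl i) = 0%N by rewrite /G !state_addE !unit_state_mulnE ffunE !muln0.
have GE l : G l = g + 'u_p *+ l + 'u_q *+ (m - l)%N by [].
have dI i : d (inl i) = alpha i by rewrite ffunE.
have dR v : d (inr v) = 0%N by rewrite ffunE.
clearbody G d.
pose b l := flow src tgt w (edges E) (fun g => (g == d)%:R) (G l).
have bE l : (l <= m)%N -> b l =
  \sum_(a | (is_table a && fixes beta D a) && (colsum a j0 == l))
    \prod_(j | j \notin D') y j ^+ colsum a j.
  move=> lm; rewrite /b (flow_expand (M := M)) //; last first.
  - move=> e; apply: leq_trans alphaM; rewrite sumD /tgt; case: ifP => _.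
      rewrite GS; case: (eqVneq e.2 j0) => [->|_].
        by rewrite (negPf j0D); lia.
      by case: ifP => eD; rewrite muln0 // (bigD1 e.2) //= addn0 -addnA leq_addr.
    by rewrite GN; lia.
  - by move=> x; rewrite dR.
  - by rewrite filter_uniq // enum_uniq.
  rewrite [RHS]big_mkcond [LHS]big_mkcond /=; apply: eq_bigr => a _.
  rewrite wE /is_table; case: ifP => //= sa.
  have -> : (G l + shift src a == d + shift tgt a) =
      [forall i, rowsum a i == alpha i] && fixes beta D a && (colsum a j0 == l).
    apply/eqP/andP => [/ffunP h|[/andP[r c] cl]].
      have hS j : G l (inr (Some j)) = if j \in D' then colsum a j else 0%N.
        by rewrite -tgtE; have := h (inr (Some j)); rewrite !state_addE src0 dR addn0.
      split; first (apply/andP; split).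
      - apply/forallP => i; have := h (inl i); rewrite !state_addE GI srcE dI tgt0.
        by rewrite add0n addn0 => ->.
      - apply/forallP => j; apply/implyP => jD; have := hS j.
        rewrite GS inE jD orbT; case: (eqVneq j j0) => [jj|_]; last by rewrite muln0 addn0 => ->.
        by rewrite -jj jD in j0D.
      - by have := hS j0; rewrite GS (negPf j0D) eqxx muln1 j0D' => <-.
    have ta : is_table a by rewrite /is_table sa.
    apply/ffunP => -[i|[j|]]; rewrite !state_addE ?dI ?dR.
    - by rewrite GI srcE tgt0 addn0 (eqP (forallP r i)).
    - rewrite GS src0 tgtE addn0 add0n !inE; case: (eqVneq j j0) => [->|_] /=.
        by rewrite (negPf j0D) (eqP cl) muln1.
      by case: ifP => jD; rewrite muln0 ?addn0 // (eqP (implyP (forallP c j) jD)).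
    (* Balance at the merged sink follows from the other equations, since row sums and column sums
       have the same total. *)
    rewrite GN src0 tgtN addn0 add0n; have := sum_colsum ta.
    rewrite sumD [RHS](bigID (mem D')) /= D'E (eqP cl).
    rewrite (eq_bigr (colsum a)) => [|j jD]; last by rewrite (eqP (implyP (forallP c j) jD)).
    lia.
  by rewrite mulr_natr mulrb.
have j0m : (beta j0 <= m)%N by rewrite /m (bigD1 j0) //= leq_addr.
set L' := L * _.
have cap : (forall t, 0 < t -> L' * t ^+ beta j0 <= \sum_(l < m.+1) b l * t ^+ l) ->
    L' <= cc (beta j0) * b (beta j0).
  move=> h; rewrite /b GE; apply: flow_capacity => // [e|t t0].
    by rewrite /w; case: ifP => // _; exact: ltW.
  apply: (le_trans (h t t0)); apply: ler_sum => l _.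
  by rewrite /b GE.
have colE : colpoly (j0 |: D) y =
  \sum_(a | is_table a && fixes beta D a && (colsum a j0 == beta j0))
     \prod_(j | j \notin D') y j ^+ colsum a j.
  apply: eq_bigl => a; rewrite -andbA; congr (_ && _).
  apply/forallP/andP => [h|[/forallP h1 h2] j].
    split; last by have := h j0; rewrite j0D'.
    by apply/forallP => j; have := h j; rewrite !inE; case: (j \in D); rewrite ?orbT.
  apply/implyP; rewrite !inE => /predU1P[->//|jD]; exact: (implyP (h1 j)).
rewrite colE -(bE _ j0m); apply: cap.
have colm a : is_table a -> fixes beta D a -> (colsum a j0 <= m)%N.
  move=> ta fa; have := sum_colsum ta.
  have -> : (\sum_j colsum a j = \sum_(j in D) beta j + \sum_(j | j \notin D) colsum a j)%N.
    rewrite (bigID (mem D)) /=; congr (_ + _)%N.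
    by apply: eq_bigr => j jD; rewrite (eqP (implyP (forallP fa j) jD)).
  rewrite sumD => /addnI ->; by rewrite (bigD1 j0) //= leq_addr.
clearbody b m.
move=> t t0.
(* With [t] in place of the variable of [j0], [colpoly D z] is the generating polynomial of the
   sequence [b]. *)
pose z j := if j == j0 then t else y j.
have zprod (c : J -> nat) : \prod_(j | j \notin D) z j ^+ c j =
    t ^+ c j0 * \prod_(j | j \notin D') y j ^+ c j.
  rewrite (bigD1 j0) //= {1}/z eqxx; congr (_ * _).
  apply: eq_big => [j|j /andP[_ /negPf jj]]; last by rewrite /z jj.
  by rewrite !inE negb_or andbC.
have := hL z; rewrite zprod mulrCA mulrC => hz; apply: le_trans (hz _) _.
  by move=> j; rewrite /z; case: ifP.
have colD : colpoly D z = \sum_(l < m.+1)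
    (* [inord] is faithful here: [colm] bounds the column sum by [m]. *)
    \sum_(a | (is_table a && fixes beta D a) && ((inord (colsum a j0) : 'I_m.+1) == l))
      \prod_(j | j \notin D) z j ^+ colsum a j.
  exact: partition_big.
rewrite colD; apply: ler_sum => l _.
rewrite bE ?mulr_suml; last by rewrite -ltnS.
rewrite le_eqVlt; apply/orP; left; apply/eqP.
have inordE a : is_table a -> fixes beta D a ->
    ((inord (colsum a j0) : 'I_m.+1) == l) = (colsum a j0 == l).
  move=> ta fa; have cm := colm a ta fa.
  apply/eqP/eqP => [<-|cl]; first by rewrite inordK.
  by apply: val_inj; rewrite /= inordK.
apply: eq_big => [a|a /andP[/andP[ta fa]]].
  by apply: andb_id2l => /andP[ta fa]; exact: inordE.
by rewrite inordE // zprod mulrC => /eqP ->.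
Qed.

(** Each column moved into [D] costs one factor through [colpoly_step], whose constant [L] is
    [weight] divided by the factors already paid. *)
Lemma colpoly_ge D y : (forall j, 0 < y j) ->
  weight * \prod_(j | j \notin D) y j ^+ beta j <=
  (\prod_(j in D) cc (beta j)) * colpoly D y.
Proof.
have [k] := ubnP #|D|; elim: k D y => // k IH D y Dk y0.
have [->|[j0 j0D]] := set_0Vmem D.
  rewrite big_set0 mul1r.
  have -> : \prod_(j | j \notin finset.set0) y j ^+ beta j = \prod_j y j ^+ beta j.
    by apply: eq_bigl => j; rewrite inE.
  exact: colpoly0_ge.
have DE : D = j0 |: (D :\ j0) by rewrite finset.setD1K.
set D1 := D :\ j0 in DE; have j0D1 : j0 \notin D1 by rewrite !inE eqxx.
have D1k : (#|D1| < k)%N by rewrite -ltnS (leq_trans _ Dk) // ltnS [leqRHS](cardsD1 j0) j0D.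
pose c := \prod_(j in D1) cc (beta j).
have c0 : 0 < c by apply: prodr_gt0 => j _; exact: capacity_const_gt0.
set W := weight.
have h : W / c * \prod_(j | j \notin D) y j ^+ beta j <= cc (beta j0) * colpoly D y.
  rewrite DE; apply: colpoly_step => // z z0.
  by rewrite mulrAC ler_pdivrMr // [leRHS]mulrC IH.
have -> : \prod_(j in D) cc (beta j) = c * cc (beta j0) by rewrite DE big_setU1 //= mulrC.
have -> : W = c * (W / c) by rewrite mulrC mulfVK ?gt_eqF.
by rewrite -[c * (W / c) * _]mulrA -[c * cc _ * _]mulrA ler_pM2l.
Qed.

(** All columns but [j0] are extracted and the remaining variable is set to 1. The sum of column
    [j0] is then forced by the total, so it costs no factor. *)
Lemma tables_lower_bound (j0 : J) :
  \prod_i \prod_(j | E i j) Tfun (A i j) <=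
  \prod_i cc (alpha i) * \prod_(j | j != j0) cc (beta j) *
  #|[set a : table | is_table a && [forall j, colsum a j == beta j]]|%:R.
Proof.
have h := @colpoly_ge [set~ j0] (fun=> 1) (fun=> ltr01).
have e1 : \prod_(j | j \notin [set~ j0]) (1 : R) ^+ beta j = 1.
  by rewrite big1 // => j _; rewrite expr1n.
rewrite e1 mulr1 ler_pdivrMr in h; last by apply: prodr_gt0 => i _; exact: capacity_const_gt0.
apply: (le_trans h); rewrite [leLHS]mulrC mulrA; rewrite le_eqVlt; apply/orP; left; apply/eqP.
congr (_ * _ * _).
  by apply: eq_bigl => j; rewrite !inE.
rewrite /colpoly (eq_bigr (fun=> 1)) => [|a _]; last by rewrite big1 // => j _; rewrite expr1n.
rewrite sumr_const; congr (_ *+ _); apply: eq_card => a; rewrite inE [in LHS]unfold_in.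
have [ta|] := boolP (is_table a) => //=.
apply/forallP/forallP => [h1 j|h1 j]; last by apply/implyP.
have [->|jj0] := eqVneq j j0; last by apply: (implyP (h1 j)); rewrite !inE.
have := sum_colsum ta; rewrite sum_margins (bigD1 j0) //= [RHS](bigD1 j0) //=.
rewrite (eq_bigr (colsum a)) => [/addIn ->//|i ij0].
by apply/esym/eqP/(implyP (h1 i)); rewrite !inE.
Qed.

End Columns.

(** * The staircase table of a flow *)

Section Staircase.
Variables (U : zmodType) (n : nat).

(** For [i = 0] the antidiagonal index [n - i] is outside the range, hence the conditional. *)
Lemma sum_staircase (F : nat -> U) i : (i < n)%N ->
  (forall j, (j < n)%N -> (n < i + j)%N -> F j = 0) ->
  \sum_(0 <= j < n) F j =
  \sum_(0 <= j < n - i) F j + (if (0 < i)%N then F (n - i)%N else 0).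
Proof.
case: i => [|i] iN F0; first by rewrite subn0 addr0.
rewrite [LHS](big_cat_nat (n := n - i.+1)) ?leq_subr //=; congr (_ + _).
rewrite big_ltn; last by lia.
rewrite big_nat big1 ?addr0 // => j /andP[h1 h2]; apply: F0 => //; lia.
Qed.

Lemma sum_rev (F : nat -> U) m : (m <= n)%N ->
  \sum_(0 <= j < m) F (n - j)%N = \sum_((n - m).+1 <= j < n.+1) F j.
Proof.
elim: m => [_|m IH mn]; first by rewrite subn0 !big_geq.
have -> : ((n - m.+1).+1 = n - m)%N by lia.
rewrite big_nat_recr //= IH ?(ltnW mn) // [in RHS]big_ltn 1?addrC //; lia.
Qed.

End Staircase.

Lemma sum_ord_nat (U : zmodType) n (P : pred nat) (F : nat -> U) :
  (forall j, (j < n)%N -> ~~ P j -> F j = 0) ->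
  \sum_(j < n | P j) F j = \sum_(0 <= j < n) F j.
Proof.
move=> F0; rewrite big_mkcond /= (big_mkord predT); apply: eq_bigr => j _.
by case: ifP => // /negbT /F0 ->.
Qed.

(** * Nonnegativity and margins of the matrix of a real flow *)

Section Polytope.
Variables (R : realType) (n : nat) (N : nat -> int) (f : nat -> nat -> R).
Hypothesis n_gt0 : (0 < n)%N.
Hypothesis fP : inFlowPolytope n N f.

(* The entry [a_(i, n-i)]. *)
Definition slack i : R := \sum_(0 <= k < i) ((N k)%:~R - f k i).

Lemma spartE k : (k < n)%N -> spart n N k = \sum_(0 <= j < k.+1) N j.
Proof.
move=> kn; rewrite /spart !big_nat; apply: eq_bigr => j /andP[_ jk].
by rewrite /Nfull (leq_trans jk).
Qed.

Lemma Nfull_last : Nfull n N n = - spart n N n.-1.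
Proof. by rewrite spartE ?prednK // big_mkord /Nfull ltnn. Qed.

Lemma netflow i : (i <= n)%N ->
  \sum_(i.+1 <= j < n.+1) f i j = (Nfull n N i)%:~R + \sum_(0 <= k < i) f k i.
Proof. by case: fP => _ h /h <-; rewrite subrK. Qed.

(** The flow between vertices below [i] cancels, so their total supply is what crosses the cut. *)
Lemma cut_flow i : (i <= n)%N ->
  \sum_(0 <= k < i) (N k)%:~R = \sum_(0 <= k < i) \sum_(i <= j < n.+1) f k j.
Proof.
elim: i => [_|i IH iN]; first by rewrite !big_geq.
rewrite big_nat_recr // [RHS]big_nat_recr //= netflow ?(ltnW iN) // /Nfull iN IH ?(ltnW iN) //.
have -> : \sum_(0 <= k < i) \sum_(i <= j < n.+1) f k j =
    \sum_(0 <= k < i) f k i + \sum_(0 <= k < i) \sum_(i.+1 <= j < n.+1) f k j.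
  rewrite -big_split; apply: eq_bigr => k _.
  by rewrite big_ltn // ltnS ltnW.
ring.
Qed.

(** By [cut_flow] the slack is the total flow on the edges that jump over [i]. *)
Lemma slack_ge0 i : (i <= n)%N -> 0 <= slack i.
Proof.
move=> iN; rewrite /slack sumrB cut_flow // -sumrB big_nat sumr_ge0 // => k /andP[_ ki].
rewrite big_ltn ?ltnS // addrC addKr big_nat sumr_ge0 // => j /andP[ij jn].
by case: fP => h _; apply: h; lia.
Qed.

(** Column 0 would need an antidiagonal entry in row [n], which does not exist; its value would be
    this one. *)
Lemma slack_last : slack n = 0.
Proof.
rewrite /slack sumrB; apply/eqP; rewrite subr_eq0; apply/eqP.
have := netflow (leqnn n); rewrite big_geq // => /esym/eqP; rewrite addrC addr_eq0 => /eqP ->.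
by rewrite Nfull_last spartE ?prednK // rmorphN opprK rmorph_sum.
Qed.

Lemma spart_ge0 k : (k < n)%N -> 0 <= spart n N k.
Proof.
move=> kn; rewrite -(ler0z R) spartE // rmorph_sum cut_flow //= big_nat.
apply: sumr_ge0 => l /andP[_ lk]; rewrite big_nat; apply: sumr_ge0 => j /andP[kj jn].
by case: fP => h _; apply: h; lia.
Qed.

Lemma Amat_lt i j : (i + j < n)%N -> Amat n N f i j = f i (n - j)%N.
Proof. by move=> h; rewrite /Amat ifT //; lia. Qed.

Lemma Amat_gt i j : (n < i + j)%N -> Amat n N f i j = 0.
Proof.
by move=> h; rewrite /Amat ifF ?ifF //; apply/negbTE; rewrite ?negb_and; lia.
Qed.

Lemma Amat_eq i j : (0 < i)%N -> (i < n)%N -> (i + j = n)%N -> Amat n N f i j = slack i.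
Proof.
by move=> i0 iN h; rewrite /Amat ifF ?ifT //; lia.
Qed.

Lemma Amat_ge0 i j : (i < n)%N -> (j < n)%N -> 0 <= Amat n N f i j.
Proof.
move=> iN jN; case: (ltngtP (i + j)%N n) => h.
- by rewrite Amat_lt //; case: fP => h1 _; apply: h1; lia.
- by rewrite Amat_gt.
- by rewrite Amat_eq ?slack_ge0 //; lia.
Qed.

(** The outflow of [i] is [N i] plus its inflow, and the slack cancels the inflow. *)
Lemma Amat_row i : (i < n)%N ->
  \sum_(0 <= j < n) Amat n N f i j = (spart n N i)%:~R.
Proof.
move=> iN; rewrite (@sum_staircase _ _ _ i) // => [|j _]; last exact: Amat_gt.
rewrite big_nat (eq_bigr (fun j => f i (n - j)%N)) => [|j /andP[_ jn]]; last first.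
  by rewrite Amat_lt //; lia.
rewrite -big_nat sum_rev ?leq_subr // subKn ?(ltnW iN) // netflow ?(ltnW iN) // /Nfull iN.
have -> : (if (0 < i)%N then Amat n N f i (n - i)%N else 0) = slack i.
  case: ifP => i0; first by rewrite Amat_eq //; lia.
  by rewrite /slack big_geq //; lia.
rewrite spartE // big_nat_recr //= rmorphD rmorph_sum /slack sumrB /=; ring.
Qed.

(** Column [j] holds the flow into vertex [n - j], and the slack replaces each of these terms by the
    supply [N k]. *)
Lemma Amat_col j : (j < n)%N ->
  \sum_(0 <= i < n) Amat n N f i j = (spart n N (n.-1 - j)%N)%:~R.
Proof.
move=> jN; rewrite (@sum_staircase _ _ (fun i => Amat n N f i j) j) // => [|i _]; last first.
  by rewrite addnC; exact: Amat_gt.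
rewrite big_nat (eq_bigr (fun i => f i (n - j)%N)) => [|i /andP[_ iN]]; last first.
  by rewrite Amat_lt //; lia.
rewrite -big_nat.
have -> : (if (0 < j)%N then Amat n N f (n - j)%N j else 0) = slack (n - j)%N.
  case: ifP => j0; first by rewrite Amat_eq //; lia.
  by rewrite (_ : j = 0)%N ?subn0 ?slack_last //; lia.
rewrite spartE; last by lia.
have -> : ((n.-1 - j).+1 = n - j)%N by lia.
by rewrite /slack sumrB rmorph_sum addrC subrK.
Qed.

End Polytope.

(** * Injection of integer tables into integer flows *)

Section Encoding.
Variables (m M : nat) (N : nat -> int).
Local Notation n := m.+1.
Hypothesis s_ge0 : forall k, (k < n)%N -> 0 <= spart n N k.

Definition row_margin (i : 'I_n) : nat := `|spart n N i|%N.
Definition col_margin (j : 'I_n) : nat := `|spart n N (n.-1 - j)%N|%N.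
Definition staircase (i j : 'I_n) : bool := (i + j <= n)%N.

Local Notation table := {ffun 'I_n * 'I_n -> 'I_M.+1}.
Local Notation tables := [set a : table | is_table staircase row_margin a &&
  [forall j, colsum a j == col_margin j]].

Definition entry (a : table) (i j : nat) : nat := a (inord i, inord j).

(** Inverts [Amat] on the entries with [i + j < n]. The cap in [inord] is harmless for tables with
    the right margins, by [entry_le]. *)
Definition flow_of_table (a : table) :=
  [ffun i : 'I_n.+1 => [ffun j : 'I_n.+1 =>
    (inord (if (i < j)%N then entry a i (n - j) else 0%N) : 'I_(flowBound n N).+1)]].

Lemma flowBound_spart k : (k < n)%N -> (`|spart n N k| <= flowBound n N)%N.
Proof.
move=> kn; rewrite spartE // /flowBound -(big_mkord predT (fun k => `|N k|%N)).
rewrite [leqRHS](big_cat_nat (n := k.+1)) //=.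
apply: leq_trans (leq_addr _ _); elim: k.+1 {kn} => [|l IH]; first by rewrite !big_geq.
rewrite !big_nat_recr //=; move: IH; set A := bigop _ _ _; set B := bigop _ _ _; lia.
Qed.

Section OneTable.
Variable a : table.
Hypothesis aT : a \in tables.

Lemma entry_out i j : (i < n)%N -> (j < n)%N -> (n < i + j)%N -> entry a i j = 0%N.
Proof.
move: aT; rewrite inE => /andP[/andP[]]; rewrite supported_edges => /forallP h _ _.
move=> iN jN ij; have /forallP /(_ (inord j)) := h (inord i).
by rewrite /staircase !inordK // -ltnNge ij => /eqP; rewrite /entry => ->.
Qed.

Lemma entry_row i : (i < n)%N ->
  \sum_(0 <= j < n) (entry a i j)%:Z = spart n N i.
Proof.
move: aT; rewrite inE => /andP[/andP[_ /forallP h] _] iN.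
have /eqP := h (inord i); rewrite /row_margin inordK // => e.
rewrite -[RHS](gez0_abs (s_ge0 iN)) -e /rowsum (big_morph Posz PoszD (erefl 0%:Z)).
by rewrite big_mkord; apply: eq_bigr => j _; rewrite /entry inord_val.
Qed.

Lemma entry_col j : (j < n)%N ->
  \sum_(0 <= i < n) (entry a i j)%:Z = spart n N (n.-1 - j)%N.
Proof.
move: aT; rewrite inE => /andP[_ /forallP h] jN.
have /eqP := h (inord j); rewrite /col_margin inordK // => e.
have jN' : (n.-1 - j < n)%N by lia.
rewrite -[RHS](gez0_abs (s_ge0 jN')) -e /colsum (big_morph Posz PoszD (erefl 0%:Z)).
by rewrite big_mkord; apply: eq_bigr => i _; rewrite /entry inord_val.
Qed.

Lemma entry_row_split i : (i < n)%N ->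
  spart n N i = \sum_(0 <= j < n - i) (entry a i j)%:Z +
    (if (0 < i)%N then (entry a i (n - i))%:Z else 0).
Proof.
move=> iN; rewrite -entry_row // (@sum_staircase _ _ _ i) // => j jN ij.
by rewrite entry_out.
Qed.

Lemma entry_col_split i : (0 < i)%N -> (i <= n)%N ->
  spart n N i.-1 = \sum_(0 <= k < i) (entry a k (n - i))%:Z +
    (if (i < n)%N then (entry a i (n - i))%:Z else 0).
Proof.
move=> i0 iN; have -> : (i.-1 = n.-1 - (n - i))%N by lia.
rewrite -entry_col; last by lia.
rewrite (@sum_staircase _ n (fun k => (entry a k (n - i))%:Z) (n - i)).
- by rewrite subKn // subn_gt0.
- lia.
- by move=> k kN h; rewrite entry_out //; lia.
Qed.

Lemma entry_le i j : (i < n)%N -> (j < n)%N -> (entry a i j <= flowBound n N)%N.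
Proof.
move=> iN jN; apply: leq_trans (flowBound_spart iN).
rewrite -lez_nat gez0_abs ?s_ge0 // -entry_row // big_mkord (bigD1 (Ordinal jN)) //=.
by rewrite lerDl sumr_ge0.
Qed.

Lemma flow_of_tableE (i j : 'I_n.+1) :
  flow_of_table a i j = (if (i < j)%N then entry a i (n - j) else 0%N) :> nat.
Proof.
rewrite !ffunE inordK // ltnS; case: ifP => // ij; apply: entry_le; last lia.
by apply: leq_trans ij _; rewrite -ltnS.
Qed.

(** The netflow at [v] is a part of row [v] minus a part of column [n - v]. The missing antidiagonal
    entry is common to both, so the difference of the two margins, which is [N v], remains; the end
    vertices have only a row or only a column. *)
Lemma flow_of_table_in : flow_of_table a \in intFlows n N.
Proof.
rewrite inE; apply/andP; split; apply/forallP => v.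
  by apply/forallP => j; apply/implyP => jv; rewrite flow_of_tableE ltnNge jv.
have vN : (v <= n)%N by rewrite -ltnS.
have -> : \sum_(j < n.+1 | (v < j)%N) (flow_of_table a v j : nat)%:Z =
    \sum_(0 <= j < n - v) (entry a v j)%:Z.
  transitivity (\sum_(v.+1 <= j < n.+1) (entry a v (n - j))%:Z).
    rewrite big_geq_mkord /=; apply: eq_bigr => j vj.
    by rewrite flow_of_tableE vj.
  have := @sum_rev int n (fun j => (entry a v (n - j))%:Z) (n - v) (leq_subr _ _).
  rewrite subKn // => <-; rewrite !big_nat; apply: eq_bigr => j /andP[_ jv].
  by rewrite subKn //; lia.
have -> : \sum_(k < n.+1 | (k < v)%N) (flow_of_table a k v : nat)%:Z =
    \sum_(0 <= k < v) (entry a k (n - v))%:Z.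
  rewrite big_mkord (big_ord_widen n.+1 (fun k => (entry a k (n - v))%:Z)) ?(leqW vN) //.
  by apply: eq_bigr => k kv; rewrite flow_of_tableE kv.
apply/eqP; have [vn|nv] := ltnP v n; last first.
  have -> : v = n :> nat by apply/eqP; rewrite eqn_leq vN.
  have := entry_col_split (ltn0Sn m) (leqnn n); rewrite ltnn addr0 => <-.
  by rewrite subnn big_geq // sub0r Nfull_last.
rewrite /Nfull vn; have := entry_row_split vn.
case: (posnP v) => [v0|v_gt0].
  by rewrite v0 addr0 => <-; rewrite spartE // big_nat1 [X in _ - X]big_geq //  subr0.
have := entry_col_split v_gt0 vN; rewrite vn.
have -> : spart n N v = spart n N v.-1 + N v.
  by rewrite !spartE ?prednK ?big_nat_recr //; lia.
lra.
Qed.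

End OneTable.

(** Entries with [i + j < n] are read off the flow, those with [i + j > n] vanish, and the
    antidiagonal one is determined by its row sum. *)
Lemma flow_of_table_inj : {in tables &, injective flow_of_table}.
Proof.
move=> a b aT bT ab.
have below i j : (i < n)%N -> (i + j < n)%N -> entry a i j = entry b i j.
  move=> iN ij; have i1 : (i < n.+1)%N by lia.
  have j1 : (n - j < n.+1)%N by lia.
  have := congr1 (fun g : {ffun 'I_n.+1 -> {ffun 'I_n.+1 -> 'I_(flowBound n N).+1}} =>
    (g (Ordinal i1) (Ordinal j1) : nat)) ab.
  rewrite /= !flow_of_tableE //= ifT; last by lia.
  by rewrite ifT ?subKn //; lia.
apply/ffunP => -[i j]; apply: val_inj.
suff : entry a i j = entry b i j by rewrite /entry !inord_val.
case: (ltngtP (i + j)%N n) => ij; first exact: below.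
  by rewrite !entry_out.
have jE : (j = n - i :> nat)%N by lia.
have i0 : (0 < i)%N by have := ltn_ord j; lia.
have := entry_row_split aT (ltn_ord i); rewrite (entry_row_split bT (ltn_ord i)) i0 -jE.
rewrite [in X in X = _]big_nat [in X in _ = X]big_nat.
rewrite (eq_bigr (fun j => (entry a i j)%:Z)) => [/addrI[]//|k /andP[_ ki]].
by rewrite below //; lia.
Qed.

Lemma card_tables_le : (#|tables| <= K n N)%N.
Proof.
rewrite -(card_in_imset flow_of_table_inj); apply: subset_leq_card.
by apply/fintype.subsetP => _ /imsetP[a aT ->]; exact: flow_of_table_in.
Qed.

End Encoding.

(** * From the table count to the flow count *)

Unset Implicit Arguments.

Theorem theorem3p2 (R : realType) (n : nat) (N : nat -> int) (f : nat -> nat -> R) :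
  (1 <= n)%N ->
  inFlowPolytope n N f ->
  ((K n N)%:R : R) >=
    (\big[Num.max/0]_(i < n) Tfun ((spart n N i)%:~R : R))
    * (\prod_(i < n) (Tfun ((spart n N i)%:~R : R))^-1) ^+ 2
    * \prod_(i < n) \prod_(j < n | (i + j <= n)%N) Tfun (Amat n N f i j).
Proof.
case: n => // m _ fP.
have s_ge0 k : (k < m.+1)%N -> 0 <= spart m.+1 N k by apply: (spart_ge0 _ fP).
pose T (i : 'I_m.+1) : R := Tfun ((spart m.+1 N i)%:~R : R).
have T0 i : 0 < T i by rewrite Tfun_gt0 // ler0z s_ge0.
have TE i : T i = capacity_const R (row_margin N i).
  by rewrite -Tfun_nat /T /row_margin natr_absz ger0_norm ?s_ge0.
(* The default 0 of the maximum is harmless: the range is nonempty and all [T i] are positive. *)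
have [i0 ->] : exists i0, \big[Num.max/0]_(i < m.+1) T i = T i0.
  rewrite (bigmax_eq_arg _ ord0) //; last by move=> i _; exact: ltW.
  by eexists.
pose M := (\sum_(i < m.+1) row_margin N i)%N.
have rowA (i : 'I_m.+1) : \sum_(j | staircase i j) Amat m.+1 N f i j = (row_margin N i)%:R.
  rewrite (sum_ord_nat (P := fun j => (i + j <= m.+1)%N) (F := Amat m.+1 N f i)).
    by rewrite Amat_row // natr_absz ger0_norm ?s_ge0.
  by move=> j _; rewrite -ltnNge; exact: Amat_gt.
have colA (j : 'I_m.+1) : \sum_(i | staircase i j) Amat m.+1 N f i j = (col_margin N j)%:R.
  rewrite (sum_ord_nat (P := fun i => (i + j <= m.+1)%N) (F := fun i => Amat m.+1 N f i j)).
    rewrite Amat_col // natr_absz ger0_norm ?s_ge0 //; lia.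
  by move=> i _; rewrite -ltnNge; exact: Amat_gt.
have A0 (i j : 'I_m.+1) : 0 <= Amat m.+1 N f i j by exact: Amat_ge0.
(* Column [rev_ord i0] has margin [s_(i0)], so leaving it free saves exactly the maximal factor. *)
have := @tables_lower_bound R _ _ M _ _ _ (fun i j : 'I_m.+1 => Amat m.+1 N f i j)
  A0 rowA colA (leqnn _) (rev_ord i0).
set P := \prod_i \prod_(j | _) _; set k := #|_|.
have kK : (k <= K m.+1 N)%N := card_tables_le M s_ge0.
have -> : \prod_(i < m.+1) capacity_const R (row_margin N i) = \prod_i T i.
  by apply: eq_bigr => i _; rewrite TE.
have -> : \prod_(j | j != rev_ord i0) capacity_const R (col_margin N j) =
    \prod_(i | i != i0) T i.
  rewrite (reindex_inj rev_ord_inj) /=; apply: eq_big => [i|i _].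
    by rewrite (inj_eq rev_ord_inj).
  by rewrite TE /col_margin /row_margin /= subKn // -ltnS.
rewrite prodfV; set W := \prod_i T i; set W' := \prod_(i | _) T i.
have WE : W = T i0 * W' by rewrite /W (bigD1 i0).
have W'0 : 0 < W' by apply: prodr_gt0.
have W0 : 0 < W by rewrite WE mulr_gt0.
move=> hP; have {}hP : P <= (K m.+1 N)%:R * (W * W').
  apply: (le_trans hP); rewrite mulrC ler_wpM2r ?ler_nat //.
  by rewrite mulr_ge0 ?(ltW W0) ?(ltW W'0).
(* One of the two copies of [W] loses its factor [T i0] to the maximum and becomes [W']. *)
have -> : T i0 * W^-1 ^+ 2 * P = P / (W * W').
  by rewrite WE; field; rewrite !gt_eqF.
by rewrite ler_pdivrMr ?mulr_gt0.
Qed.
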